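(* Let $F$ be a finite field, let $m\ge 1$ be an integer, and let $\rho$ be a representation (continuous homomorphism) of the absolute Galois group of $F$ in $\mathfrak{S}_{2m+1}$. Then the twist ${}^{\rho}\overline{\mathcal M}_{0,2m+1}$ is rational over $F$.
   Context: $\overline{\mathcal M}_{0,n}$ is the moduli space of stable $n$-pointed curves of genus zero; $\mathfrak{S}_n$ acts on it by permuting the marked points. For a homomorphism $\rho$ from the absolute Galois group of $F$ to $\mathfrak{S}_n$, the twist ${}^{\rho}\overline{\mathcal M}_{0,n}$ is the $F$-variety obtained by Galois descent, twisting the standard Galois action on $\overline{\mathcal M}_{0,n}$ over $\overline{F}$ by $\rho$. *)

(* Defs.v *)
(* MathComp + Multinomials.

   Varieties over a finite field F are handled in the classical way: a variety
   over an algebraic closure K of F, embedded in a product of projective lines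
   over K, together with a descent datum, i.e. a continuous semilinear action
   of Gal(K/F).  As F is perfect and quasi-projective descent is effective,
   such data are the same thing as (reduced, quasi-projective) F-varieties:
   F-open subsets correspond to Galois-stable open subsets and F-morphisms to
   Galois-equivariant K-morphisms. *)
From HB Require Import structures.
From mathcomp Require Export all_boot all_order all_fingroup all_algebra.
From mathcomp.multinomials Require Import mpoly.

Set Implicit Arguments.
Unset Strict Implicit.
Unset Printing Implicit Defensive.

Import GRing.Theory.
Local Open Scope ring_scope.

(** * Subsets of products of projective lines *)

(* [Some a] is the point [a : 1] and [None] is the point [1 : 0]. *)
Definition P1 (K : fieldType) : Type := option K.
HB.instance Definition _ (K : fieldType) := Choice.on (P1 K).

Section Projective.
Variable K : fieldType.
Implicit Types (I J : finType).

Definition hcoord (x : P1 K) : K * K :=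
  if x is Some a then (a, 1) else (1, 0).

(* The point [a : b], meaningful when (a, b) <> (0, 0). *)
Definition of_hcoord (a b : K) : P1 K :=
  if b == 0 then None else Some (a / b).

(* The points of the product of the P^1 indexed by I. *)
Definition P1pow I : Type := {ffun I -> P1 K}.

(* Multihomogeneous forms on (P^1)^I are polynomials in variables indexed by
   I + I: [inl i] and [inr i] are the two homogeneous coordinates on the i-th
   factor. *)
Definition form I := {mpoly K[#|{: I + I}|]}.

Definition hcoords I (x : P1pow I) (s : I + I) : K :=
  match s with
  | inl i => (hcoord (x i)).1
  | inr i => (hcoord (x i)).2
  end.

Definition form_eval I (P : form I) (x : P1pow I) : K :=
  P.@[fun k => hcoords x (enum_val k)].

Definition multihom I (d : I -> nat) (P : form I) : Prop :=
  forall m, m \in msupp P ->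
  forall i : I, (m (enum_rank (inl i : I + I)) + m (enum_rank (inr i : I + I)))%N = d i.

(* Zariski topology on a subset X of (P^1)^I; the sets on which one
   multihomogeneous form does not vanish are a basis. *)
Definition zopen I (X U : P1pow I -> Prop) : Prop :=
  (forall x, U x -> X x) /\
  (forall x, U x -> exists d R,
     [/\ multihom d R, form_eval R x != 0
       & forall y, X y -> form_eval R y != 0 -> U y]).

Definition zdense I (X U : P1pow I -> Prop) : Prop :=
  forall W, zopen X W -> (exists x, W x) -> exists x, W x /\ U x.

(* f is a morphism on X: each of its P^1-valued components is, locally on X,
   of the form [P : Q] with P and Q multihomogeneous of the same multidegree
   and without common zeros. *)
Definition morphism_on I J (X : P1pow I -> Prop) (f : P1pow I -> P1pow J) : Prop :=
  forall x j, X x -> exists d P Q e R,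
    [/\ multihom d P, multihom d Q, multihom e R, form_eval R x != 0
      & forall y, X y -> form_eval R y != 0 ->
          (form_eval P y, form_eval Q y) != (0, 0) /\
          f y j = of_hcoord (form_eval P y) (form_eval Q y)].

Lemma morphism_on_select I J (X : P1pow I -> Prop) (h : J -> I) :
  morphism_on X (fun x => [ffun j => x (h j)] : P1pow J).
Proof.
move=> x j _.
pose v s : form I := 'X_(enum_rank (s : I + I)).
have evE s y : form_eval (v s) y = hcoords y s.
  by rewrite /form_eval /v mevalXU enum_rankK.
have hom (s : I + I) : (s = inl (h j)) \/ (s = inr (h j)) ->
    multihom (fun i => (i == h j) : nat) (v s).
  move=> Hs m; rewrite /v msuppX inE => /eqP -> i; rewrite !mnm1E.
  rewrite !(inj_eq enum_rank_inj).
  by case: Hs => ->; rewrite [i == _]eq_sym ?addn0 ?add0n.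
exists (fun i => (i == h j) : nat), (v (inl (h j))), (v (inr (h j))).
exists (fun => 0%N), 1; split; first by apply: hom; left.
- by apply: hom; right.
- by move=> m; rewrite msupp1 inE => /eqP -> i; rewrite !mnm0E.
- by rewrite /form_eval meval1 oner_neq0.
move=> y _ _; rewrite !evE ffunE /=; case: (y (h j)) => [a|] /=.
  by rewrite /of_hcoord oner_eq0 divr1 -pair_eqE /= oner_eq0 andbF.
by rewrite /of_hcoord eqxx -pair_eqE /= oner_eq0.
Qed.

End Projective.

(** * The absolute Galois group and descent data *)

Section Galois.
Variables (F : fieldType) (K : closedFieldType) (iota : {rmorphism F -> K}).

Record absgal := AbsGal {
  absgal_fun :> {rmorphism K -> K};
  absgal_bij : bijective absgal_fun;
  absgal_fix : forall a : F, absgal_fun (iota a) = iota a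
}.

Definition conj_P1 (s : absgal) (x : P1 K) : P1 K := omap s x.

Definition conj_pt (I : finType) (s : absgal) (x : P1pow K I) : P1pow K I :=
  [ffun i => conj_P1 s (x i)].

(* Group-theoretic conditions are stated for any u that agrees with the
   composite of s and t, so that no group structure on [absgal] is needed; the
   continuity condition is the one for the Krull topology and the discrete
   topology on 'S_n.  Note that the product of permutations in MathComp is the
   opposite of the composition of functions. *)
Record galrep (n : nat) := GalRep {
  galrep_fun :> absgal -> 'S_n;
  galrepM : forall s t u : absgal, (forall a, u a = s (t a)) ->
    forall i, galrep_fun u i = galrep_fun s (galrep_fun t i);
  galrep_cont : forall s : absgal, exists A : seq K, forall t : absgal,
    {in A, t =1 s} -> galrep_fun t = galrep_fun s
}.

(* The subset [var_pt] carries the structure induced by its embedding; that it is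
   locally closed holds in the examples below but is not recorded. *)
Record variety := Variety {
  var_idx : finType;
  var_pt :> P1pow K var_idx -> Prop;
  var_act : absgal -> P1pow K var_idx -> P1pow K var_idx;
  var_act_pt : forall s x, var_pt x -> var_pt (var_act s x);
  var_act1 : forall (s : absgal) x, (forall a, s a = a) -> var_pt x -> var_act s x = x;
  var_actM : forall (s t u : absgal) x, (forall a, u a = s (t a)) ->
    var_pt x -> var_act u x = var_act s (var_act t x);
  var_act_semilinear : forall s : absgal, exists phi : P1pow K var_idx -> P1pow K var_idx,
    morphism_on (fun y => exists2 x, var_pt x & y = conj_pt s x) phi /\
    forall x, var_pt x -> var_act s x = phi (conj_pt s x);
  var_act_cont : forall x, var_pt x -> exists A : seq K,
    forall s : absgal, {in A, forall a, s a = a} -> var_act s x = x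
}.

Lemma conj_pt1 (I : finType) (s : absgal) (x : P1pow K I) :
  (forall a, s a = a) -> conj_pt s x = x.
Proof.
by move=> s1; apply/ffunP => i; rewrite ffunE /conj_P1; case: (x i) => //= a; rewrite s1.
Qed.

Lemma conj_ptM (I : finType) (s t u : absgal) (x : P1pow K I) :
  (forall a, u a = s (t a)) -> conj_pt u x = conj_pt s (conj_pt t x).
Proof.
by move=> uE; apply/ffunP => i; rewrite !ffunE /conj_P1; case: (x i) => //= a; rewrite uE.
Qed.

Lemma conj_pt_cont (I : finType) (x : P1pow K I) : exists A : seq K,
  forall s : absgal, {in A, forall a, s a = a} -> conj_pt s x = x.
Proof.
exists (pmap (fun i => x i : option K) (enum I)) => s sA; apply/ffunP => i; rewrite ffunE.
rewrite /conj_P1; case xi: (x i) => [a|] //=; rewrite sA //.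
by rewrite mem_pmap -xi (map_f (fun i => x i : option K)) // mem_enum.
Qed.

(* F-birational equivalence: an F-isomorphism between dense F-open subsets. *)
Definition birational (X Y : variety) : Prop :=
  exists (U : P1pow K (var_idx X) -> Prop) (V : P1pow K (var_idx Y) -> Prop)
    (f : P1pow K (var_idx X) -> P1pow K (var_idx Y))
    (g : P1pow K (var_idx Y) -> P1pow K (var_idx X)),
  [/\ [/\ zopen X U, zdense X U & forall s x, U x -> U (var_act s x)],
      [/\ zopen Y V, zdense Y V & forall s y, V y -> V (var_act s y)],
      [/\ morphism_on U f, forall x, U x -> V (f x) & forall x, U x -> g (f x) = x],
      [/\ morphism_on V g, forall y, V y -> U (g y) & forall y, V y -> f (g y) = y]
    & forall s x, U x -> f (var_act s x) = var_act s (f x)].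

Definition affine_pt (d : nat) (x : P1pow K 'I_d) : Prop :=
  forall i, x i <> None.

Lemma affine_act_pt d (s : absgal) (x : P1pow K 'I_d) :
  affine_pt x -> affine_pt (conj_pt s x).
Proof. by move=> x_aff i; rewrite ffunE /conj_P1; move: (x_aff i); case: (x i). Qed.

Lemma affine_semilinear d (s : absgal) : exists phi : P1pow K 'I_d -> P1pow K 'I_d,
  morphism_on (fun y => exists2 x, affine_pt x & y = conj_pt s x) phi /\
  forall x, affine_pt x -> conj_pt s x = phi (conj_pt s x).
Proof.
exists (fun x => [ffun i => x (id i)]); split; first exact: morphism_on_select.
by move=> x _; apply/ffunP => i; rewrite [RHS]ffunE.
Qed.

(* Affine d-space over F, as the subset of (P^1)^d with no coordinate at
   infinity. *)
Definition affine_space (d : nat) : variety :=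
  @Variety 'I_d (@affine_pt d) (@conj_pt 'I_d) (@affine_act_pt d)
    (fun s x s1 _ => conj_pt1 x s1) (fun s t u x uE _ => conj_ptM x uE)
    (@affine_semilinear d) (fun x _ => conj_pt_cont x).

Definition rational (X : variety) : Prop := exists d, birational X (affine_space d).

End Galois.

(** * Stable n-pointed curves of genus zero and their moduli space *)

(* A connected nodal curve has arithmetic genus zero exactly when its components
   are projective lines and its dual graph is a tree. *)
Definition is_tree (V : finType) (e : rel V) : Prop :=
  [/\ ssrbool.symmetric e, irreflexive e
    & forall v w, exists! p : seq V, [/\ path e v p, last v p = w & uniq (v :: p)]].

(* [sc_node v w], for v and w adjacent, is the point of the component v that is
   glued to the point [sc_node w v] of the component w. *)
Record stable_curve (K : fieldType) (n : nat) := StableCurve {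
  sc_comp : finType;
  sc_adj : rel sc_comp;
  sc_node : sc_comp -> sc_comp -> P1 K;
  sc_mark_comp : 'I_n -> sc_comp;
  sc_mark : 'I_n -> P1 K;
  sc_nonempty : (0 < #|sc_comp|)%N;
  sc_tree : is_tree sc_adj;
  sc_node_inj : forall v w1 w2, sc_adj v w1 -> sc_adj v w2 ->
    sc_node v w1 = sc_node v w2 -> w1 = w2;
  sc_mark_inj : forall i j, sc_mark_comp i = sc_mark_comp j ->
    sc_mark i = sc_mark j -> i = j;
  sc_mark_smooth : forall i w, sc_adj (sc_mark_comp i) w ->
    sc_mark i <> sc_node (sc_mark_comp i) w;
  sc_stable : forall v,
    (3 <= #|[set w | sc_adj v w]| + #|[set i | sc_mark_comp i == v]|)%N
}.

(* x is the image of the i-th marked point under the map from C onto its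
   component v that contracts all the other components. *)
Definition projects_to (K : fieldType) n (C : stable_curve K n)
    (v : sc_comp C) (i : 'I_n) (x : P1 K) : Prop :=
  (sc_mark_comp C i = v /\ x = sc_mark C i) \/
  (exists w p, [/\ path (@sc_adj _ _ C) v (w :: p), uniq (v :: w :: p),
                   last w p = sc_mark_comp C i & x = sc_node v w]).

Record quad (n : nat) := Quad {
  quad_fun :> {ffun 'I_4 -> 'I_n};
  quad_inj : injectiveb quad_fun
}.
HB.instance Definition _ n := [isSub for @quad_fun n].
HB.instance Definition _ n := [Finite of quad n by <:].

Definition bracket (K : fieldType) (x y : P1 K) : K :=
  (hcoord x).1 * (hcoord y).2 - (hcoord x).2 * (hcoord y).1.

(* (y0 - y2)(y1 - y3) / (y0 - y3)(y1 - y2), which makes sense as a point of P^1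
   as soon as no three of the points y0, ..., y3 coincide. *)
Definition cross_ratio (K : fieldType) (y : 'I_4 -> P1 K) : P1 K :=
  let z k := y (inord k) in
  of_hcoord (bracket (z 0) (z 2) * bracket (z 1) (z 3))
            (bracket (z 0) (z 3) * bracket (z 1) (z 2)).

Definition no_three_equal (K : fieldType) (y : 'I_4 -> P1 K) : Prop :=
  forall a b c : 'I_4, uniq [:: a; b; c] -> ~ (y a = y b /\ y b = y c).

(* c is the family of the cross-ratios of C.  For each quadruple q there are
   components v of C on which no three of the images of the marked points of q
   coincide, and they all give the same value. *)
Definition has_cross_ratios (K : fieldType) n (C : stable_curve K n)
    (c : P1pow K (quad n)) : Prop :=
  forall q : quad n, exists (v : sc_comp C) (y : 'I_4 -> P1 K),
    [/\ forall k, projects_to v (q k) (y k), no_three_equal y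
      & c q = cross_ratio y].

(* The points of the moduli space of stable n-pointed curves of genus zero over
   K.  The cross-ratios identify the set of isomorphism classes of stable curves
   with a subset of (P^1)^(quad n), and the scheme \bar M_{0,n} with a closed
   subscheme of it (Gerritzen, Herrlich and van der Put). *)
Definition Mbar (K : fieldType) n (c : P1pow K (quad n)) : Prop :=
  exists C : stable_curve K n, has_cross_ratios C c.

(** * The actions of the symmetric and of the Galois group *)

Section Twist.
Variables (F : fieldType) (K : closedFieldType) (iota : {rmorphism F -> K}) (n : nat).
Implicit Types (s t u : absgal iota) (g h : 'S_n) (C : stable_curve K n).

Fact conj_P1_inj s : injective (conj_P1 s).
Proof. by move=> [a|] [b|] //= [] /(bij_inj (absgal_bij s)) ->. Qed.

Definition conj_curve s C : stable_curve K n := {|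
  sc_comp := sc_comp C;
  sc_adj := @sc_adj _ _ C;
  sc_node := fun v w => conj_P1 s (sc_node v w);
  sc_mark_comp := sc_mark_comp C;
  sc_mark := fun i => conj_P1 s (sc_mark C i);
  sc_nonempty := sc_nonempty C;
  sc_tree := sc_tree C;
  sc_node_inj := fun v w1 w2 e1 e2 E => sc_node_inj e1 e2 (conj_P1_inj E);
  sc_mark_inj := fun i j Ec E => sc_mark_inj Ec (conj_P1_inj E);
  sc_mark_smooth := fun i w e E => sc_mark_smooth e (conj_P1_inj E);
  sc_stable := @sc_stable _ _ C
|}.

Fact relabel_stable g C (v : sc_comp C) :
  (3 <= #|[set w | sc_adj v w]| + #|[set i | sc_mark_comp C ((g^-1)%g i) == v]|)%N.
Proof.
have := sc_stable v; congr (_ <= _ + _)%N.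
rewrite -(card_imset [set i | sc_mark_comp C i == v] (@perm_inj _ g)).
congr #|pred_of_set _|; apply/setP => i; rewrite inE.
apply/imsetP/idP => [[j + ->]|vi]; first by rewrite inE permK.
by exists ((g^-1)%g i); rewrite ?inE ?permKV.
Qed.

(* The i-th marked point of the curve gC is the marked point of C with label
   g^-1 i, so that this is a left action for the composition of functions. *)
Definition relabel_curve g C : stable_curve K n := {|
  sc_comp := sc_comp C;
  sc_adj := @sc_adj _ _ C;
  sc_node := @sc_node _ _ C;
  sc_mark_comp := fun i => sc_mark_comp C ((g^-1)%g i);
  sc_mark := fun i => sc_mark C ((g^-1)%g i);
  sc_nonempty := sc_nonempty C;
  sc_tree := sc_tree C;
  sc_node_inj := @sc_node_inj _ _ C;
  sc_mark_inj := fun i j Ec E => perm_inj (sc_mark_inj Ec E);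
  sc_mark_smooth := fun i w e => sc_mark_smooth e;
  sc_stable := @relabel_stable g C
|}.

Fact relabel_quad_subproof g (q : quad n) : injectiveb [ffun k => g (q k)].
Proof.
apply/injectiveP => k l; rewrite !ffunE => /perm_inj.
by move: k l; apply/injectiveP; case: q.
Qed.

Definition relabel_quad g (q : quad n) : quad n := Quad (relabel_quad_subproof g q).

Definition relabel_pt g (c : P1pow K (quad n)) : P1pow K (quad n) :=
  [ffun q => c (relabel_quad (g^-1)%g q)].

Lemma conj_curve_cross_ratios s C c :
  has_cross_ratios C c -> has_cross_ratios (conj_curve s C) (conj_pt s c).
Proof.
move=> Cc q; have [v [y [yP y3 cE]]] := Cc q.
exists v, (fun k => conj_P1 s (y k)); split=> [k|a b c' abc [E1 E2]|].
- case: (yP k) => [[kv ->]|[w [p [pP pU pL ->]]]]; first by left.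
  by right; exists w, p; split.
- by apply: (y3 a b c' abc); split; apply: (@conj_P1_inj s).
have hcE x : hcoord (conj_P1 s x) = (s (hcoord x).1, s (hcoord x).2).
  by case: x => [a|] /=; rewrite ?rmorph1 ?rmorph0.
have brE x z : bracket (conj_P1 s x) (conj_P1 s z) = s (bracket x z).
  by rewrite /bracket !hcE rmorphB !rmorphM.
rewrite ffunE cE /cross_ratio !brE -!rmorphM /of_hcoord fmorph_eq0.
by case: ifP => //= _; rewrite fmorph_div.
Qed.

Lemma relabel_curve_cross_ratios g C c :
  has_cross_ratios C c -> has_cross_ratios (relabel_curve g C) (relabel_pt g c).
Proof.
move=> Cc q; have [v [y [yP y3 cE]]] := Cc (relabel_quad (g^-1)%g q).
exists v, y; split=> // [k|]; last by rewrite ffunE.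
by have := yP k; rewrite /= ffunE.
Qed.

Definition twisted_act (rho : galrep iota n) s (c : P1pow K (quad n)) :=
  relabel_pt (rho s) (conj_pt s c).

Lemma twisted_act_pt (rho : galrep iota n) s c : Mbar c -> Mbar (twisted_act rho s c).
Proof.
case=> C Cc; exists (relabel_curve (rho s) (conj_curve s C)).
exact/relabel_curve_cross_ratios/conj_curve_cross_ratios.
Qed.

Lemma relabel_pt1 c : relabel_pt 1%g c = c.
Proof.
apply/ffunP => q; rewrite ffunE; congr (c _); apply: val_inj.
by apply/ffunP => k; rewrite /= ffunE invg1 perm1.
Qed.

Lemma relabel_ptM g h c : relabel_pt (h * g)%g c = relabel_pt g (relabel_pt h c).
Proof.
apply/ffunP => q; rewrite !ffunE; congr (c _); apply: val_inj.
by apply/ffunP => k; rewrite /= !ffunE /= ?ffunE invMg permM.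
Qed.

Lemma relabel_conj g s c : conj_pt s (relabel_pt g c) = relabel_pt g (conj_pt s c).
Proof. by apply/ffunP => q; rewrite !ffunE. Qed.

Lemma galrep1 (rho : galrep iota n) s : (forall a, s a = a) -> rho s = 1%g.
Proof.
move=> s1; apply/permP => i; rewrite perm1; apply: (@perm_inj _ (rho s)).
by rewrite -(galrepM rho (s := s) (t := s) (u := s)) // => a; rewrite !s1.
Qed.

Lemma twisted_act1 (rho : galrep iota n) s c :
  (forall a, s a = a) -> Mbar c -> twisted_act rho s c = c.
Proof. by move=> s1 _; rewrite /twisted_act galrep1 // relabel_pt1 conj_pt1. Qed.

Lemma twisted_actM (rho : galrep iota n) s t u c : (forall a, u a = s (t a)) ->
  Mbar c -> twisted_act rho u c = twisted_act rho s (twisted_act rho t c).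
Proof.
move=> uE _; rewrite /twisted_act relabel_conj -relabel_ptM -(conj_ptM _ uE).
by congr (relabel_pt _ _); apply/permP => i; rewrite permM (galrepM rho uE).
Qed.

Lemma twisted_act_semilinear (rho : galrep iota n) s :
  exists phi : P1pow K (quad n) -> P1pow K (quad n),
  morphism_on (fun y => exists2 x, Mbar x & y = conj_pt s x) phi /\
  forall x, Mbar x -> twisted_act rho s x = phi (conj_pt s x).
Proof. by exists (relabel_pt (rho s)); split=> //; apply: morphism_on_select. Qed.

Lemma twisted_act_cont (rho : galrep iota n) c : Mbar c -> exists A : seq K,
  forall s, {in A, forall a, s a = a} -> twisted_act rho s c = c.
Proof.
move=> _; have [A cA] := @conj_pt_cont _ _ iota _ c.
have bij_id : bijective (idfun : K -> K) by exists idfun.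
pose e := @AbsGal _ _ iota (idfun : {rmorphism K -> K}) bij_id (fun=> erefl).
have [B rhoB] := galrep_cont rho e; exists (A ++ B) => s sAB.
rewrite /twisted_act cA => [|a aA]; last by rewrite sAB // mem_cat aA.
rewrite (rhoB s) => [|a aB]; last by rewrite sAB // mem_cat aB orbT.
by rewrite galrep1 // relabel_pt1.
Qed.

(* The twist of \bar M_{0,n} by rho. *)
Definition twisted_Mbar (rho : galrep iota n) : variety iota :=
  @Variety _ _ iota (quad n) (@Mbar K n) (twisted_act rho) (@twisted_act_pt rho)
    (@twisted_act1 rho) (@twisted_actM rho) (@twisted_act_semilinear rho)
    (@twisted_act_cont rho).

End Twist.

(* Main.v *)
(* Let n = 2m + 1 and let S be a Galois-stable set of 2r + 3 labels.  A rational
   map of degree r + 1 has as many parameters as there are points in S, so the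
   marked points x_i on P^1 determine, for given parameters p_i, a unique map P/Q
   of degree r + 1 with x_i = (P/Q)(p_i) on S.  Changing coordinates on the target
   replaces (P, Q) by another basis of the plane spanned by P and Q, which
   therefore depends only on the point of M_{0,n}; putting it in row echelon
   form gives 2r coordinates and fixes a coordinate on P^1, in which the
   remaining points are arbitrary.  If p is Galois-equivariant then so are these
   coordinates, apart from the remaining points, whose coordinates become
   rational after a linear change of variables.  Such p and S exist over a
   finite field: the permutation g given by the Frobenius has an odd cycle of
   length at least 3, or a fixed point and an even cycle, or is trivial; in the
   last case an arbitrary pencil on three points takes the place of the
   polynomials.

   The open set of M_{0,n} thus obtained is dense in the moduli space of stable
   curves because a stable curve can be smoothed along a path of curves and two
   generic configurations lie on a line. *)
From HB Require Import structures.
Require Import Defs.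
From mathcomp.multinomials Require Import mpoly.
From mathcomp Require Import ring zify cyclic separable cyclotomic finfield.

Set Implicit Arguments.
Unset Strict Implicit.
Unset Printing Implicit Defensive.

Import GRing.Theory.
Local Open Scope ring_scope.

(** * Regular functions on subsets of products of projective lines *)

(** The points of a configuration are known only through cross-ratios, hence up to PGL_2, and a
    frame that moves three labels to oo, 0, 1 is not compatible with the Galois action. Row
    reduction of the interpolant cancels the choice of frame. Equivariance is therefore proved for
    the map from affine space to the moduli space, where no frame occurs, and its inverse inherits
    it. Interpolation is stated as linear equations in the coefficients of P and Q, which admits
    base points; genericity then means that the solutions form a line. There are [2r + 4]
    coefficients and [2r + 3] equations, so maximal minors give a solution that is regular in the
    points. This count forces S to have odd size. The parity of n excludes the one remaining kind of
    permutation, that with all cycles of even length. The parameters lie on the affine line: those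
    of a cycle of length d are the conjugates of an element of degree d, and a fixed point next to
    an even cycle gets 0. For the trivial permutation three rational parameters would be required,
    but the affine line over a field of two elements has only two; the substitute is the triple oo,
    0, 1 of the projective line. *)

Section Forms.
Variables (K : fieldType) (I : finType).
Implicit Types (d : I -> nat) (P Q : form K I) (y : P1pow K I).

Lemma form_evalM P Q y : form_eval (P * Q) y = form_eval P y * form_eval Q y.
Proof. by rewrite /form_eval mevalM. Qed.

Lemma form_evalD P Q y : form_eval (P + Q) y = form_eval P y + form_eval Q y.
Proof. by rewrite /form_eval mevalD. Qed.

Lemma form_evalC c y : form_eval (c%:MP) y = c.
Proof. by rewrite /form_eval mevalC. Qed.

Lemma form_evalX s y : form_eval 'X_(enum_rank s) y = hcoords y s.
Proof. by rewrite /form_eval mevalXU enum_rankK. Qed.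

Lemma multihomM d1 d2 P Q :
  multihom d1 P -> multihom d2 Q -> multihom (fun i => d1 i + d2 i)%N (P * Q).
Proof.
move=> hP hQ m /msuppM_le /allpairsP [[m1 m2] [/= /hP h1 /hQ h2 ->]] i.
by rewrite !mnmDE -h1 -h2; lia.
Qed.

Lemma multihomD d P Q : multihom d P -> multihom d Q -> multihom d (P + Q).
Proof. by move=> hP hQ m /msuppD_le; rewrite mem_cat => /orP[/hP|/hQ]. Qed.

Lemma multihomC c : multihom (fun=> 0%N) (c%:MP : form K I).
Proof.
move=> m; rewrite msuppC; case: eqP => // _.
by rewrite inE => /eqP -> i; rewrite !mnm0E.
Qed.

Lemma multihomX i (s : I + I) : s = inl i \/ s = inr i ->
  multihom (fun j => (j == i) : nat) ('X_(enum_rank s) : form K I).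
Proof.
move=> Hs m; rewrite msuppX inE => /eqP -> j; rewrite !mnm1E.
rewrite !(inj_eq enum_rank_inj).
by case: Hs => ->; rewrite [j == _]eq_sym ?addn0 ?add0n.
Qed.

(** [form_eval] is computed in the normalised coordinates of [hcoord]. This gives access to any
    other homogeneous coordinates, at the cost of a factor that is nonzero when all [u i] are. *)
Lemma form_eval_rescale d P y (A B : I -> K) (u : I -> K) :
    multihom d P ->
    (forall i, A i = u i * (hcoord (y i)).1) ->
    (forall i, B i = u i * (hcoord (y i)).2) ->
  P.@[fun k => match enum_val k with inl i => A i | inr i => B i end]
    = (\prod_i u i ^+ d i) * form_eval P y.
Proof.
move=> hP hA hB; rewrite /form_eval !mevalE mulr_sumr big_seq [RHS]big_seq.
apply: eq_bigr => m /hP hm; rewrite mulrCA; congr (_ * _).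
have sumE (f : I + I -> K) :
    \prod_(k : 'I_#|{: I + I}|) f (enum_val k) ^+ m k
      = \prod_i (f (inl i) ^+ m (enum_rank (inl i : I + I)) *
                 f (inr i) ^+ m (enum_rank (inr i : I + I))).
  rewrite (reindex (@enum_rank (I + I)%type)) /=; last first.
    by exists enum_val => k _; [exact: enum_rankK|exact: enum_valK].
  rewrite big_sumType /= -big_split /=.
  by apply: eq_bigr => i _; rewrite !enum_rankK.
rewrite (sumE (fun s => match s with inl i => A i | inr i => B i end)).
rewrite (sumE (hcoords y)) -big_split; apply: eq_bigr => i _ /=.
by rewrite hA hB !exprMn -(hm i) exprD mulrACA.
Qed.

(** One fraction valid on all of [D], which is stronger than the local condition of [morphism_on]
    and is preserved by the field operations. *)
Definition regular (D : P1pow K I -> Prop) (h : P1pow K I -> K) : Prop :=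
  exists d P Q, [/\ multihom d P, multihom d Q
    & forall y, D y -> form_eval Q y != 0 /\ h y = form_eval P y / form_eval Q y].

(** A single form serves both purposes: it makes the set open, and for density it leaves one
    polynomial to keep nonzero along a curve. *)
Definition principal (D : P1pow K I -> Prop) : Prop :=
  exists d T, multihom d T /\ forall y, D y <-> form_eval T y != 0.

Section Closure.
Variable D : P1pow K I -> Prop.

Lemma regular_ext h h' : (forall y, D y -> h y = h' y) -> regular D h -> regular D h'.
Proof.
move=> hh' [d [P [Q [hP hQ hE]]]]; exists d, P, Q; split=> // y Dy.
by rewrite -hh' //; apply: hE.
Qed.

Lemma regularC c : regular D (fun=> c).
Proof.
exists (fun=> 0%N), c%:MP, 1%:MP; split; try exact: multihomC.
by move=> y _; rewrite !form_evalC oner_neq0 divr1.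
Qed.

Lemma regularM h1 h2 : regular D h1 -> regular D h2 -> regular D (fun y => h1 y * h2 y).
Proof.
move=> [d1 [P1 [Q1 [hP1 hQ1 E1]]]] [d2 [P2 [Q2 [hP2 hQ2 E2]]]].
exists (fun i => d1 i + d2 i)%N, (P1 * P2), (Q1 * Q2).
split; try exact: multihomM.
move=> y Dy; have [n1 ->] := E1 y Dy; have [n2 ->] := E2 y Dy.
by rewrite !form_evalM mulf_neq0 // mulf_div.
Qed.

Lemma regularD h1 h2 : regular D h1 -> regular D h2 -> regular D (fun y => h1 y + h2 y).
Proof.
move=> [d1 [P1 [Q1 [hP1 hQ1 E1]]]] [d2 [P2 [Q2 [hP2 hQ2 E2]]]].
exists (fun i => d1 i + d2 i)%N, (P1 * Q2 + Q1 * P2), (Q1 * Q2).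
split; first by apply: multihomD; apply: multihomM.
  exact: multihomM.
move=> y Dy; have [n1 ->] := E1 y Dy; have [n2 ->] := E2 y Dy.
rewrite form_evalD !form_evalM mulf_neq0 // addf_div //.
by rewrite [form_eval P2 y * _]mulrC.
Qed.

Lemma regularN h : regular D h -> regular D (fun y => - h y).
Proof.
by move=> hh; apply: regular_ext (regularM (regularC (-1)) hh) => y _; rewrite mulN1r.
Qed.

Lemma regularB h1 h2 : regular D h1 -> regular D h2 -> regular D (fun y => h1 y - h2 y).
Proof. by move=> r1 r2; apply: regularD => //; apply: regularN. Qed.

Lemma regularV h : (forall y, D y -> h y != 0) -> regular D h ->
  regular D (fun y => (h y)^-1).
Proof.
move=> h0 [d [P [Q [hP hQ E]]]]; exists d, Q, P; split=> // y Dy.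
have [nQ hE] := E y Dy; have := h0 y Dy; rewrite hE mulf_eq0 negb_or => /andP [-> _].
by rewrite invf_div.
Qed.

Lemma regular_sum (J : Type) (s : seq J) (p : pred J) (h : J -> P1pow K I -> K) :
  (forall j, p j -> regular D (h j)) -> regular D (fun y => \sum_(j <- s | p j) h j y).
Proof.
move=> rh; elim: s => [|j s IH].
  by apply: regular_ext (regularC 0) => y _; rewrite big_nil.
case pj: (p j); last by apply: regular_ext IH => y _; rewrite big_cons pj.
by apply: regular_ext (regularD (rh j pj) IH) => y _; rewrite big_cons pj.
Qed.

Lemma regular_prod (J : Type) (s : seq J) (p : pred J) (h : J -> P1pow K I -> K) :
  (forall j, p j -> regular D (h j)) -> regular D (fun y => \prod_(j <- s | p j) h j y).
Proof.
move=> rh; elim: s => [|j s IH].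
  by apply: regular_ext (regularC 1) => y _; rewrite big_nil.
case pj: (p j); last by apply: regular_ext IH => y _; rewrite big_cons pj.
by apply: regular_ext (regularM (rh j pj) IH) => y _; rewrite big_cons pj.
Qed.

Lemma regular_det k (M : P1pow K I -> 'M[K]_k) :
  (forall i j, regular D (fun y => M y i j)) -> regular D (fun y => \det (M y)).
Proof.
move=> rM; apply: regular_sum => s _; apply: regularM; first exact: regularC.
exact: regular_prod.
Qed.

Lemma regular_coord i : (forall y, D y -> y i != None) ->
  regular D (fun y => odflt 0 (y i)).
Proof.
move=> Di; exists (fun j => (j == i) : nat).
exists 'X_(enum_rank (inl i)), 'X_(enum_rank (inr i)).
split; [by apply: multihomX; left|by apply: multihomX; right|].
move=> y Dy; rewrite !form_evalX /=; move: (Di y Dy); case: (y i) => //= a _.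
by rewrite oner_neq0 divr1.
Qed.

Lemma principal_neq0 h : principal D -> regular D h ->
  principal (fun y => D y /\ h y != 0).
Proof.
move=> [d [T [hT DT]]] [d' [P [Q [hP hQ hE]]]].
exists (fun i => d i + d' i)%N, (T * P); split; first exact: multihomM.
move=> y; rewrite form_evalM mulf_eq0 negb_or; split.
  move=> [Dy]; have [nQ ->] := hE y Dy; rewrite mulf_eq0 negb_or => /andP [-> _].
  by rewrite andbT; apply/DT.
case/andP => /DT Dy nP; split=> //; have [nQ ->] := hE y Dy.
by rewrite mulf_neq0 // invr_eq0.
Qed.

End Closure.

Lemma principal_finite : principal (fun y => forall i, y i != None).
Proof.
have fin_prod (y : P1pow K I) :
    (forall i, y i != None) <-> \prod_i hcoords y (inr i) != 0.
  split=> [yfin|/prodf_neq0 y0 i].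
    by apply/prodf_neq0 => i _; move: (yfin i); rewrite /=; case: (y i) => //= a;
      rewrite oner_neq0.
  by move: (y0 i isT); rewrite /=; case: (y i) => //=; rewrite eqxx.
have: exists d (T : form K I), multihom d T /\
    forall y, form_eval T y = \prod_i hcoords y (inr i).
  elim: (index_enum I) => [|i s [d [T [hT TE]]]].
    exists (fun=> 0%N), 1%:MP; split; first exact: multihomC.
    by move=> y; rewrite form_evalC big_nil.
  exists (fun j => (j == i) + d j)%N, ('X_(enum_rank (inr i)) * T); split.
    by apply: multihomM => //; apply: multihomX; right.
  by move=> y; rewrite form_evalM form_evalX TE big_cons.
by case=> d [T [hT TE]]; exists d, T; split=> // y; rewrite TE.
Qed.

Lemma zopen_principal (X D : P1pow K I -> Prop) :
  principal D -> zopen X (fun y => X y /\ D y).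
Proof.
move=> [d [T [hT DT]]]; split=> [x []//|x [Xx /DT Dx]].
by exists d, T; split=> // y Xy /DT.
Qed.

End Forms.

Lemma morphism_on_regular (K : fieldType) (I J : finType) (X : P1pow K I -> Prop)
    (f : P1pow K I -> P1pow K J) (h : J -> P1pow K I -> K) :
    (forall j, regular X (h j)) -> (forall x j, X x -> f x j = Some (h j x)) ->
  morphism_on X f.
Proof.
move=> rh fE x j Xx; have [d [P [Q [hP hQ hE]]]] := rh j.
exists d, P, Q, (fun=> 0%N), 1%:MP; split=> //; first exact: multihomC.
  by rewrite form_evalC oner_neq0.
move=> y Xy _; have [nQ hy] := hE y Xy; split.
  by rewrite -pair_eqE /= (negbTE nQ) andbF.
by rewrite fE // /of_hcoord (negbTE nQ) hy.
Qed.

(** * Polynomial curves and avoidance of finite sets *)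

Section PolyCurve.
Variable K : fieldType.

(** Along a polynomial curve a form becomes a polynomial in one variable, so that nonvanishing at
    one parameter extends to all but finitely many. *)
Lemma horner_meval k (P : {mpoly K[k]}) (v : 'I_k -> {poly K}) :
  exists p : {poly K}, forall t, p.[t] = P.@[fun i => (v i).[t]].
Proof.
exists (\sum_(m <- msupp P) (P@_m)%:P * \prod_i v i ^+ m i) => t.
rewrite horner_sum mevalE; apply: eq_bigr => m _.
rewrite hornerM hornerC horner_prod; congr (_ * _).
by apply: eq_bigr => i _; rewrite horner_exp.
Qed.

End PolyCurve.

Section Infinite.
Variable K : closedFieldType.

Lemma closed_field_avoid (A : seq K) : exists x : K, x \notin A.
Proof.
(* This polynomial takes the value 1 on [A]; the factor ['X] keeps it nonconstant when [A] is
   empty. *)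
pose p := (\prod_(a <- A) ('X - a%:P) * 'X + 1 : {poly K}).
have p1 : (size p != 1)%N.
  rewrite /p size_polyDl ?size_mulX ?monic_neq0 ?monic_prod_XsubC //.
    by rewrite size_prod_XsubC.
  by rewrite size_prod_XsubC size_poly1.
have [x /rootP] := closed_rootP p p1; rewrite /p !hornerE => px.
exists x; apply/negP => xA; move: px.
have -> : (\prod_(a <- A) ('X - a%:P)).[x] = 0.
  by apply/rootP; rewrite root_prod_XsubC.
by rewrite mul0r add0r => /eqP; rewrite oner_eq0.
Qed.

Lemma poly_nonroot (p : {poly K}) : p != 0 -> exists x, p.[x] != 0.
Proof.
move=> p0; have [r pE] := closed_field_poly_normal p.
have [x xr] := closed_field_avoid r; exists x.
by rewrite pE hornerZ mulf_neq0 ?lead_coef_eq0 //; move: xr; rewrite -root_prod_XsubC.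
Qed.

Lemma injective_avoid (T : finType) (A : seq K) :
  exists x : T -> K, injective x /\ forall t, x t \notin A.
Proof.
have: exists s : seq K, [/\ size s = #|T|, uniq s & all (fun z => z \notin A) s].
  elim: #|T| => [|k [s [ss us As]]]; first by exists [::].
  have [x] := closed_field_avoid (s ++ A); rewrite mem_cat negb_or => /andP[xs xA].
  by exists (x :: s); rewrite /= ss xs us xA As.
case=> s [ss us /allP As]; exists (fun t => nth 0 s (enum_rank t)).
have lts (t : T) : (enum_rank t < size s)%N by rewrite ss.
split=> [t t' /eqP|t]; last by apply: As; rewrite mem_nth.
by rewrite nth_uniq // => /eqP /ord_inj /enum_rank_inj.
Qed.

End Infinite.

(** * Trees and projections of the marked points *)

Section Trees.
Variables (V : finType) (e : rel V).
Hypothesis e_tree : is_tree e.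

Lemma tree_path v w : exists p, [/\ path e v p, uniq (v :: p) & last v p = w].
Proof.
by have [_ _ /(_ v w) [p [[? ? ?] _]]] := e_tree; exists p; split.
Qed.

Lemma tree_path_eq v p q : path e v p -> uniq (v :: p) -> path e v q -> uniq (v :: q) ->
  last v p = last v q -> p = q.
Proof.
move=> pP uP pQ uQ lE; have [_ _ /(_ v (last v p)) [r [_ rE]]] := e_tree.
by rewrite -(rE p) // -(rE q).
Qed.

(** A step to a neighbour lengthens or shortens a simple path: if [v] lies on the path from [u], the
    part up to [v] is the edge itself, by uniqueness of simple paths. *)
Lemma tree_adj_path v u p : e v u -> path e u p -> uniq (u :: p) ->
  (path e v (u :: p) /\ uniq (v :: u :: p)) \/ exists p', p = v :: p'.
Proof.
have [e_sym e_irr _] := e_tree; move=> vu pP uP.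
have [vup|] := boolP (v \in u :: p); last by left; rewrite /= vu pP; split=> //; apply/andP.
move: vup; rewrite inE => /orP [/eqP vE|]; first by rewrite vE e_irr in vu.
move=> vp; case/splitPr: vp pP uP => p1 p2 pP uP; right.
suff -> : p1 = [::] by exists p2.
have : rcons p1 v = [:: v].
  apply: (@tree_path_eq u).
  - by move: pP; rewrite cat_path rcons_path /= => /and3P [-> ->].
  - by move: uP; rewrite -cat_rcons -cat_cons cat_uniq => /and3P [].
  - by rewrite /= e_sym vu.
  - by rewrite /= inE andbT; apply/eqP => uv; rewrite uv e_irr in vu.
  - by rewrite last_rcons.
by case: p1 {pP uP} => // a [].
Qed.

(** Two simple paths that leave [v] along different edges join to a simple path. Seen from [v'], the
    end of [q] therefore lies in the direction of [last v p], the vertex before [v']. *)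
Lemma tree_path_back p v v' q :
    path e v (rcons p v') -> uniq (v :: rcons p v') -> path e v q -> uniq (v :: q) ->
    ohead q != ohead (rcons p v') ->
  exists q', [/\ path e v' (last v p :: q'), uniq (v' :: last v p :: q')
               & last (last v p) q' = last v q].
Proof.
have [e_sym _ _] := e_tree.
elim: p v q => [|w p IH] v q pP uP pQ uQ hq.
  exists q; move: pP; rewrite /= andbT e_sym => v'v.
  have [[h1 h2]|[q' qE]] := tree_adj_path v'v pQ uQ; first by split.
  by rewrite qE eqxx in hq.
move: pP uP; rewrite rcons_cons => /= /andP [vw pP] /andP [vwp uP].
have wv : e w v by rewrite e_sym.
have [[pQ' uQ']|[q' qE]] := tree_adj_path wv pQ uQ; last by rewrite qE eqxx in hq.
have [|q' [h1 h2 h3]] := IH w (v :: q) pP uP pQ' uQ'; last by exists q'; split.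
apply: contraNneq vwp => /= vE; rewrite inE.
suff -> : v \in rcons p v' by rewrite orbT.
by case: (p) vE => [|a s] [->] /=; rewrite inE eqxx.
Qed.

End Trees.

Section Projections.
Variables (K : fieldType) (n : nat) (C : stable_curve K n).
Implicit Types (v : sc_comp C) (i : 'I_n) (x : P1 K).

Lemma projects_to_ex v i : exists x, projects_to v i x.
Proof.
have [[|w p] [pP uP lP]] := tree_path (sc_tree C) v (sc_mark_comp C i).
  by exists (sc_mark C i); left.
by exists (sc_node v w); right; exists w, p.
Qed.

Lemma projects_to_eq v i x x' : projects_to v i x -> projects_to v i x' -> x = x'.
Proof.
have no_loop w p : path (@sc_adj _ _ C) v (w :: p) -> uniq (v :: w :: p) -> last w p <> v.
  by move=> pP /= /andP [+ _] lE; rewrite -[X in X \notin _]lE mem_last.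
case=> [[E ->]|[w [p [pP uP lP ->]]]] [[E' ->]|[w' [p' [pP' uP' lP' ->]]]] //.
- by case: (no_loop w' p' pP' uP'); rewrite lP'.
- by case: (no_loop w p pP uP); rewrite lP.
have [->] // : w :: p = w' :: p'.
by apply: (tree_path_eq (sc_tree C) pP uP pP' uP'); rewrite /= lP lP'.
Qed.

(** [z] is the node of [v] towards [v'] and [z'] the node of [v'] towards [v]. A marked point that
    is not beyond the first is seen from [v'] through the second. *)
Lemma projects_to_separated v v' : v != v' ->
  exists z z', forall i x x', projects_to v i x -> projects_to v' i x' -> x = z \/ x' = z'.
Proof.
move=> vv'; have [p [pP uP lP]] := tree_path (sc_tree C) v v'.
case/lastP: p => [|p u] in pP uP lP; first by rewrite -lP eqxx in vv'.
rewrite last_rcons in lP; subst u.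
exists (sc_node v (head v (rcons p v'))), (sc_node v' (last v p)) => i x x' vx v'x'.
have [q [pQ uQ lQ]] := tree_path (sc_tree C) v (sc_mark_comp C i).
have [/eqP hE|hN] := boolP (ohead q == ohead (rcons p v')).
  left; apply: (projects_to_eq vx); right.
  case: q pQ uQ lQ hE => [|w q] pQ uQ lQ; first by case: (p).
  by exists w, q; split=> //; case: (p) hE => [|a b] [] ->.
right; have [q' [h1 h2 h3]] := tree_path_back (sc_tree C) pP uP pQ uQ hN.
by apply: (projects_to_eq v'x'); right; exists (last v p), q'; split=> //; rewrite h3.
Qed.

(** If the components differed, two of the three labels would collapse to the same one of the points
    [z], [z'] of [projects_to_separated]. *)
Lemma projects_to_triple v v' (i : 'I_3 -> 'I_n) (x x' : 'I_3 -> P1 K) :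
    (forall k, projects_to v (i k) (x k)) -> (forall k, projects_to v' (i k) (x' k)) ->
  injective x -> injective x' -> v = v'.
Proof.
move=> px px' ix ix'; have [//|vv'] := eqVneq v v'.
have [z [z' zP]] := projects_to_separated vv'.
have key k : x k = z \/ x' k = z' by exact: zP (px k) (px' k).
have [a b c] : [/\ ord0 <> ord_max :> 'I_3, ord0 <> inord 1 :> 'I_3 &
                  ord_max <> inord 1 :> 'I_3].
  by split=> /(congr1 val); rewrite /= ?inordK.
have := (key ord0, key ord_max, key (inord 1)).
by case=> [[[E0|E0] [E1|E1]] [E2|E2]];
  do ?[by case: a; (apply: ix + apply: ix'); rewrite E0 E1
      |by case: b; (apply: ix + apply: ix'); rewrite E0 E2
      |by case: c; (apply: ix + apply: ix'); rewrite E1 E2].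
Qed.

End Projections.

(** * Brackets, cross-ratios and configurations of points on the line *)

Definition hbr (R : comNzRingType) (u v : R * R) : R := u.1 * v.2 - u.2 * v.1.

Lemma hbrC (R : comNzRingType) (u v : R * R) : hbr u v = - hbr v u.
Proof. by rewrite /hbr; ring. Qed.

Definition cr_num (R : comNzRingType) n (X : 'I_n -> R * R) (q : quad n) : R :=
  hbr (X (q (inord 0))) (X (q (inord 2))) * hbr (X (q (inord 1))) (X (q (inord 3))).

Definition cr_den (R : comNzRingType) n (X : 'I_n -> R * R) (q : quad n) : R :=
  hbr (X (q (inord 0))) (X (q (inord 3))) * hbr (X (q (inord 1))) (X (q (inord 2))).

Section Configurations.
Variable K : fieldType.

Lemma of_hcoordP (u : K * K) : u != (0, 0) ->
  exists2 s : K, s != 0 & u = (s * (hcoord (of_hcoord u.1 u.2)).1,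
                               s * (hcoord (of_hcoord u.1 u.2)).2).
Proof.
case: u => a b; rewrite /of_hcoord -pair_eqE /=.
have [-> |b0 _] := eqVneq b 0; last by exists b => //=; rewrite mulr1 mulrC divfK.
by rewrite andbT => a0; exists a => //=; rewrite mulr1 mulr0.
Qed.

Lemma of_hcoord_scale (s a b : K) : s != 0 -> of_hcoord (s * a) (s * b) = of_hcoord a b.
Proof.
move=> s0; rewrite /of_hcoord mulf_eq0 (negbTE s0) /=.
by case: eqP => // _; rewrite -mulf_div divff // mul1r.
Qed.

Lemma bracket_eq0 (x y : P1 K) : (bracket x y == 0) = (x == y).
Proof.
rewrite /bracket; case: x y => [a|] [b|] /=.
- by rewrite mulr1 mul1r subr_eq0; apply/eqP/eqP => [->|[]].
- by rewrite mulr0 mulr1 sub0r oppr_eq0 oner_eq0.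
- by rewrite mulr1 mul0r subr0 oner_eq0.
- by rewrite mulr0 mul0r subrr !eqxx.
Qed.

Variable n : nat.
Implicit Types (X : 'I_n -> K * K) (q : quad n).

Definition independent X : Prop := forall i j, i != j -> hbr (X i) (X j) != 0.

Definition cross_ratios X : P1pow K (quad n) :=
  [ffun q => of_hcoord (cr_num X q) (cr_den X q)].

Lemma quad_neq q (a b : nat) : (a < 4)%N -> (b < 4)%N -> a != b ->
  q (inord a) != q (inord b).
Proof.
move=> a4 b4 ab; have /injectiveP q_inj := quad_inj q.
by apply: contraNneq ab => /q_inj /(congr1 val); rewrite /= !inordK // => ->.
Qed.

Lemma cr_num_neq0 X q : independent X -> cr_num X q != 0.
Proof. by move=> iX; rewrite mulf_neq0 // iX // quad_neq. Qed.

Lemma cr_den_neq0 X q : independent X -> cr_den X q != 0.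
Proof. by move=> iX; rewrite mulf_neq0 // iX // quad_neq. Qed.

Lemma cr_num_den_neq X q : independent X -> cr_num X q != cr_den X q.
Proof.
move=> iX; rewrite -subr_eq0.
(* The Plücker relation among the six brackets of four vectors. *)
have -> : cr_num X q - cr_den X q =
    hbr (X (q (inord 0))) (X (q (inord 1))) * hbr (X (q (inord 2))) (X (q (inord 3))).
  by rewrite /cr_num /cr_den /hbr; ring.
by rewrite mulf_neq0 // iX // quad_neq.
Qed.

Lemma cross_ratiosE X q : independent X -> cross_ratios X q = Some (cr_num X q / cr_den X q).
Proof. by move=> iX; rewrite ffunE /of_hcoord (negbTE (cr_den_neq0 q iX)). Qed.

(** Equivalence under PGL_2 and rescaling, expressed by brackets alone: [k] plays the part of the
    determinant of the matrix, [s i] that of the scalar at the i-th point. *)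
Definition proj_equiv X X' : Prop := exists k (s : 'I_n -> K),
  [/\ k != 0, forall i, s i != 0
    & forall i j, hbr (X i) (X j) = k * s i * s j * hbr (X' i) (X' j)].

Lemma proj_equiv_refl X : proj_equiv X X.
Proof.
by exists 1, (fun=> 1); split=> [|i|i j]; rewrite ?oner_neq0 ?mul1r.
Qed.

Lemma proj_equiv_sym X X' : proj_equiv X X' -> proj_equiv X' X.
Proof.
move=> [k [s [k0 s0 E]]]; exists k^-1, (fun i => (s i)^-1).
split=> [|i|i j]; rewrite ?invr_eq0 // E.
by field; rewrite k0 !s0.
Qed.

Lemma proj_equiv_trans X X' X'' :
  proj_equiv X X' -> proj_equiv X' X'' -> proj_equiv X X''.
Proof.
move=> [k [s [k0 s0 E]]] [k' [s' [k0' s0' E']]]; exists (k * k'), (fun i => s i * s' i).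
by split=> [|i|i j]; rewrite ?mulf_neq0 // E E'; ring.
Qed.

Lemma proj_equiv_independent X X' : proj_equiv X X' -> independent X' -> independent X.
Proof.
move=> [k [s [k0 s0 E]]] iX i j ij; rewrite E !mulf_neq0 //; exact: iX.
Qed.

Lemma proj_equiv_cross_ratio X X' q : proj_equiv X X' -> cross_ratios X q = cross_ratios X' q.
Proof.
move=> [k [s [k0 s0 E]]]; rewrite !ffunE.
pose u := k ^+ 2 * (s (q (inord 0)) * s (q (inord 1)) * s (q (inord 2)) * s (q (inord 3))).
rewrite -[RHS](@of_hcoord_scale u) ?mulf_neq0 ?expf_neq0 //; congr of_hcoord;
  by rewrite /u /cr_num /cr_den !E; ring.
Qed.

Lemma proj_equiv_hcoord X : (forall i, X i != (0, 0)) ->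
  proj_equiv X (fun i => hcoord (of_hcoord (X i).1 (X i).2)).
Proof.
move=> X0.
pose h i := hcoord (of_hcoord (X i).1 (X i).2).
have /fin_all_exists [s sP] i : exists s : K, s != 0 /\ X i = (s * (h i).1, s * (h i).2).
  by have [s s0 sE] := of_hcoordP (X0 i); exists s.
exists 1, s; split=> [|i|i j]; rewrite ?oner_neq0 //; first by case: (sP i).
rewrite -[hbr _ _ in RHS]/(hbr (h i) (h j)); have [_ Xi] := sP i; have [_ Xj] := sP j.
move: (h i) (h j) Xi Xj => u w -> ->; rewrite /hbr /=; ring.
Qed.

Lemma independent_neq0 X : (1 < n)%N -> independent X -> forall i, X i != (0, 0).
Proof.
move=> n1 iX i; have [j ij] : exists j, i != j.
  have n0 : (0 < n)%N by lia.
  by have [<-|] := eqVneq (Ordinal n0) i; [exists (Ordinal n1)|rewrite eq_sym; exists (Ordinal n0)].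
by apply: contraTneq (iX i j ij) => ->; rewrite /hbr /= !mul0r subrr eqxx.
Qed.

(** The stable curve is a single projective line without nodes; [3 <= n] is its stability. *)
Lemma Mbar_cross_ratios X : (3 <= n)%N -> independent X -> Mbar (cross_ratios X).
Proof.
move=> n3 iX; pose y i : P1 K := of_hcoord (X i).1 (X i).2.
have eX : proj_equiv X (fun i => hcoord (y i)).
  by apply/proj_equiv_hcoord/independent_neq0; first by lia.
have iy : independent (fun i => hcoord (y i)).
  exact: proj_equiv_independent (proj_equiv_sym eX) iX.
have y_inj : injective y.
  move=> i j yij; apply/eqP; case: eqVneq => // ij; have := iy i j ij.
  by rewrite /= yij -[hbr _ _]/(bracket _ _) bracket_eq0 eqxx.
have tree1 : is_tree (fun _ _ : unit => false).
  split=> // -[] []; exists [::]; split=> // p [].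
  by case: p.
have node_inj (v w1 w2 : unit) : false -> false -> None = None :> P1 K -> w1 = w2 by [].
have stab (v : unit) : (3 <= #|[set w : unit | false]| + #|[set i : 'I_n | tt == v]|)%N.
  rewrite (_ : [set i : 'I_n | tt == v] = setT) ?cardsT ?card_ord; first by lia.
  by apply/setP => i; rewrite !inE; case: v.
have smooth (i : 'I_n) (w : unit) : false -> y i <> None by [].
pose C := @StableCurve K n unit (fun _ _ => false) (fun _ _ => None) (fun=> tt) y
  (etrans (congr1 (fun k => 0 < k)%N card_unit) isT) tree1 node_inj
  (fun i j _ h => y_inj i j h) smooth stab.
exists C => q; exists tt, (fun k => y (q k)); split.
- by move=> k; left.
- have /injectiveP q_inj := quad_inj q.
  move=> a b c; rewrite /= !inE negb_or => /andP [/andP [ab _] _] [/y_inj /q_inj E _].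
  by rewrite E eqxx in ab.
- by rewrite (proj_equiv_cross_ratio q eX) ffunE.
Qed.


End Configurations.

(** * Generic points of the moduli space *)

Section Smooth.
Variable K : fieldType.

Lemma bracket_xx (x : P1 K) : bracket x x = 0.
Proof. by apply/eqP; rewrite bracket_eq0. Qed.

(** A cross-ratio in which two of the four points coincide takes one of the excluded values oo, 0,
    1. *)
Definition generic_value (x : P1 K) : bool := [&& x != None, x != Some 0 & x != Some 1].

Lemma of_hcoord_xx (a : K) : ~~ generic_value (of_hcoord a a).
Proof.
rewrite /of_hcoord; have [//|a0] := eqVneq a 0.
by rewrite divff // /generic_value eqxx !andbF.
Qed.

Lemma of_hcoord_0l (a : K) : ~~ generic_value (of_hcoord 0 a).
Proof.
rewrite /of_hcoord; have [//|_] := eqVneq a 0.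
by rewrite mul0r /generic_value eqxx !andbF.
Qed.

Lemma of_hcoord_0r (a : K) : ~~ generic_value (of_hcoord a 0).
Proof. by rewrite /of_hcoord eqxx. Qed.

Lemma ord4_ind (P : 'I_4 -> Prop) :
  P (inord 0) -> P (inord 1) -> P (inord 2) -> P (inord 3) -> forall k, P k.
Proof.
move=> P0 P1 P2 P3 k; rewrite -(inord_val k).
by case: k => [[|[|[|[|]]]]].
Qed.

Lemma generic_cross_ratio_inj (y : 'I_4 -> P1 K) :
  generic_value (cross_ratio y) -> injective y.
Proof.
rewrite /cross_ratio => gy.
have [n01 n02 n03] : [/\ y (inord 0) <> y (inord 1), y (inord 0) <> y (inord 2) &
    y (inord 0) <> y (inord 3)].
  split=> E; move: gy; apply/negP; rewrite E ?bracket_xx ?mul0r ?of_hcoord_0l ?of_hcoord_0r //.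
  by rewrite mulrC of_hcoord_xx.
have [n12 n13 n23] : [/\ y (inord 1) <> y (inord 2), y (inord 1) <> y (inord 3) &
    y (inord 2) <> y (inord 3)].
  split=> E; move: gy; apply/negP; rewrite E ?bracket_xx ?mulr0 ?of_hcoord_0l ?of_hcoord_0r //.
  exact: of_hcoord_xx.
by elim/ord4_ind => //; elim/ord4_ind => // E; exfalso; move: (E) (esym E); auto.
Qed.

Variable n : nat.

Lemma quad_of (a b c d : 'I_n) : uniq [:: a; b; c; d] -> exists q : quad n,
  [/\ q (inord 0) = a, q (inord 1) = b, q (inord 2) = c & q (inord 3) = d].
Proof.
move=> u; suff q_inj : injectiveb [ffun k : 'I_4 => nth a [:: a; b; c; d] k].
  by exists (Quad q_inj); rewrite /= !ffunE !inordK.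
apply/injectiveP => k l; rewrite !ffunE => /eqP.
by rewrite nth_uniq ?ltn_ord // => /eqP /ord_inj.
Qed.

Lemma hcoord_independent (x : 'I_n -> P1 K) :
  injective x -> independent (fun i => hcoord (x i)).
Proof.
move=> x_inj i j ij; rewrite -[hbr _ _]/(bracket _ _) bracket_eq0.
by rewrite (inj_eq x_inj).
Qed.

Lemma cross_ratios_hcoord (x : 'I_n -> P1 K) q :
  cross_ratios (fun i => hcoord (x i)) q = cross_ratio (fun k => x (q k)).
Proof. by rewrite ffunE. Qed.

(** Generic cross-ratios make the four projections of every quadruple distinct on its own component.
    Quadruples that share three labels share the component, so a single component carries distinct
    images of all marked points and gives all cross-ratios. *)
Lemma Mbar_generic (c : P1pow K (quad n)) :
    (3 <= n)%N -> Mbar c -> (forall q, generic_value (c q)) ->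
  exists2 X, independent X & c = cross_ratios X.
Proof.
move=> n3 [C Cc] gc.
suff [x x_inj cE] : exists2 x : 'I_n -> P1 K, injective x &
    forall q, c q = cross_ratio (fun k => x (q k)).
  exists (fun i => hcoord (x i)); first exact: hcoord_independent.
  by apply/ffunP => q; rewrite cross_ratios_hcoord.
(* For three labels there are no quadruples, and any three distinct points will do. *)
have [n4|n4] := leqP 4 n; last first.
  have nq (q : quad n) : False.
    by have /injectiveP/leq_card := quad_inj q; rewrite !card_ord; lia.
  exists (fun i : 'I_n => nth None [:: None; Some 0; Some 1] i); last by move=> q; case: (nq q).
  have uP : uniq [:: None; Some 0; Some (1 : K)].
    by rewrite /= !inE /= andbT; apply/eqP => -[] /eqP; rewrite eq_sym oner_eq0.
  move=> i j /eqP; rewrite nth_uniq //=; try (by have := ltn_ord i; have := ltn_ord j; lia).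
  by move=> /eqP /ord_inj.
pose w k : 'I_n := widen_ord n4 k.
have w_uniq : uniq [:: w (inord 0); w (inord 1); w (inord 2); w (inord 3)].
  by rewrite /= !inE -!val_eqE /= !inordK.
have [q0 _] := quad_of w_uniq.
have cP (q : quad n) : exists v (y : 'I_4 -> P1 K), [/\ forall k, projects_to (C := C) v (q k) (y k),
    injective y & c q = cross_ratio y].
  have [v [y [yP _ yE]]] := Cc q; exists v, y; split=> //.
  by apply: generic_cross_ratio_inj; rewrite -yE.
have [v [y0 [y0P y0_inj _]]] := cP q0.
have /fin_all_exists [x xP] : forall i, exists x, projects_to v i x by apply: projects_to_ex.
(* Three distinct projections to [v] identify [v] with the component used for [q], and then the
   fourth projection is distinct as well. *)
have key (q : quad n) : x (q (inord 0)) <> x (q (inord 1)) -> x (q (inord 0)) <> x (q (inord 2)) ->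
    x (q (inord 1)) <> x (q (inord 2)) ->
    injective (fun k => x (q k)) /\ c q = cross_ratio (fun k => x (q k)).
  move=> n01 n02 n12; have [v' [y [yP y_inj yE]]] := cP q.
  pose i3 (k : 'I_3) : 'I_4 := @widen_ord 3 4 isT k.
  have vE : v = v'.
    apply: (@projects_to_triple _ _ _ _ _ (fun k => q (i3 k)) (fun k => x (q (i3 k)))
      (fun k => y (i3 k))) => //.
    - move=> k l /=; suff iE (k' : 'I_3) : i3 k' = inord k'.
        rewrite !iE; case: k l => [[|[|[|]]] // ?] [[|[|[|]]] // ?] /= E;
        by [apply: val_inj | exfalso; move: (E) (esym E); auto].
      by apply: val_inj; rewrite /= inordK // ltnS ltnW.
    - by move=> k l /y_inj /(congr1 val) /= /ord_inj.
  have xyE : (fun k => x (q k)) =1 y.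
    by move=> k; apply: (projects_to_eq (xP (q k))); rewrite vE.
  split=> [k l|]; first by rewrite !xyE; apply: y_inj.
  by rewrite yE /cross_ratio !xyE.
have x0E k : x (q0 k) = y0 k by apply: projects_to_eq (xP _) (y0P k).
pose i k := q0 (inord k).
have q0_inj := injectiveP _ (quad_inj q0).
have ix a b : (a < 4)%N -> (b < 4)%N -> a != b -> i a != i b /\ x (i a) <> x (i b).
  move=> a4 b4 ab; split; first exact: quad_neq.
  by rewrite !x0E => /y0_inj /(congr1 val); rewrite /= !inordK // => E; rewrite E eqxx in ab.
have [[i01 x01] [i02 x02] [i12 x12]] := And3 (@ix 0 1 isT isT isT) (@ix 0 2 isT isT isT)
  (@ix 1 2 isT isT isT).
have x3 j : j \notin [:: i 0; i 1; i 2] -> x (i 0) <> x j /\ x (i 1) <> x j.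
  rewrite !inE !negb_or => /and3P [j0 j1 j2].
  have u : uniq [:: i 0; i 1; i 2; j].
    by rewrite /= !inE !negb_or i01 i02 i12 ![_ == j]eq_sym j0 j1 j2.
  have [q [E0 E1 E2 E3]] := quad_of u.
  have := key q; rewrite E0 E1 E2 => /(_ x01 x02 x12) [inj _].
  have {}inj k : (k < 3)%N -> x (q (inord k)) <> x (q (inord 3)).
    by move=> k3 /inj /(congr1 val); rewrite /= !inordK ?(ltn_trans k3) // => E; rewrite E in k3.
  by split; [move: (inj 0 isT)|move: (inj 1 isT)]; rewrite E3 ?E0 ?E1.
have x_inj : injective x.
  have x01j j k : j \in [:: i 0; i 1] -> j != k -> x j <> x k.
    move=> j01 jk; have [|/x3 [x0k x1k]] := boolP (k \in [:: i 0; i 1; i 2]).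
      by rewrite !inE in j01 *; case/or3P => /eqP kE; case/orP: j01 => /eqP jE;
        rewrite jE kE ?eqxx // in jk *; auto.
    by move: j01; rewrite !inE => /orP [] /eqP ->.
  move=> j k xjk; apply/eqP; apply: contraT => jk.
  have [/x01j /(_ jk) //|j01] := boolP (j \in [:: i 0; i 1]).
  have kj : k != j by rewrite eq_sym.
  have [/x01j /(_ kj) |k01] := boolP (k \in [:: i 0; i 1]); first by rewrite xjk.
  (* The first three labels are already known to have distinct projections, so [key] separates [j]
     from [k]. *)
  have u : uniq [:: i 0; i 1; j; k].
    move: j01 k01; rewrite /= !inE !negb_or i01 jk => /andP [j0 j1] /andP [k0 k1].
    by rewrite ![i _ == j]eq_sym ![i _ == k]eq_sym j0 j1 k0 k1.
  have [q [E0 E1 E2 E3]] := quad_of u.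
  have [|||inj _] := key q; rewrite ?E0 ?E1 ?E2 //.
  - by apply: x01j; rewrite ?inE ?eqxx // eq_sym; move: j01; rewrite !inE negb_or => /andP [].
  - by apply: x01j; rewrite ?inE ?eqxx ?orbT // eq_sym; move: j01; rewrite !inE negb_or => /andP [].
  have := @inj (inord 2) (inord 3); rewrite E2 E3 => /(_ xjk) /(congr1 val).
  by rewrite /= !inordK.
exists x => // q; have [] // := key q; move=> /x_inj /eqP; apply/negP; exact: quad_neq.
Qed.

End Smooth.

(** * Smoothing of stable curves *)

Section Curves.
Variable K : closedFieldType.

Definition ev_pair (t : K) (u : {poly K} * {poly K}) : K * K := (u.1.[t], u.2.[t]).

Definition const_pair (u : K * K) : {poly K} * {poly K} := (u.1%:P, u.2%:P).

Lemma ev_const t u : ev_pair t (const_pair u) = u.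
Proof. by rewrite /ev_pair /= !hornerC; case: u. Qed.

Lemma hbr_ev t u v : hbr (ev_pair t u) (ev_pair t v) = (hbr u v).[t].
Proof. by rewrite /hbr /= !hornerE. Qed.

Lemma cr_num_ev n t (X : 'I_n -> {poly K} * {poly K}) q :
  cr_num (fun i => ev_pair t (X i)) q = (cr_num X q).[t].
Proof. by rewrite /cr_num !hbr_ev hornerM. Qed.

Lemma cr_den_ev n t (X : 'I_n -> {poly K} * {poly K}) q :
  cr_den (fun i => ev_pair t (X i)) q = (cr_den X q).[t].
Proof. by rewrite /cr_den !hbr_ev hornerM. Qed.

Lemma form_eval_of_hcoord (I : finType) d (P : form K I) (A B : I -> K) :
    multihom d P -> (forall i, (A i, B i) != (0, 0)) ->
  (P.@[fun k => match enum_val k with inl i => A i | inr i => B i end] != 0)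
    = (form_eval P [ffun i => of_hcoord (A i) (B i)] != 0).
Proof.
move=> hP AB0; pose h i := hcoord (of_hcoord (A i) (B i)).
have /fin_all_exists [u uP] i : exists u : K, u != 0 /\ (A i, B i) = (u * (h i).1, u * (h i).2).
  by have [u u0 uE] := of_hcoordP (AB0 i); exists u.
rewrite (form_eval_rescale (y := [ffun i => of_hcoord (A i) (B i)]) (u := u) hP).
- rewrite mulf_eq0 negb_or andb_idl // => _.
  by apply/prodf_neq0 => i _; rewrite expf_neq0 //; case: (uP i).
- by move=> i; rewrite ffunE; case: (uP i) => _ [].
- by move=> i; rewrite ffunE; case: (uP i) => _ [].
Qed.

(** Homogeneous coordinates matter only up to scalars, so what is compared is nonvanishing rather
    than values, at those [t] where no pair of coordinates vanishes. *)
Lemma form_curve (I : finType) d (P : form K I) (A B : I -> {poly K}) : multihom d P ->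
  exists r : {poly K}, forall t, (forall i, ((A i).[t], (B i).[t]) != (0, 0)) ->
    (r.[t] != 0) = (form_eval P [ffun i => of_hcoord (A i).[t] (B i).[t]] != 0).
Proof.
move=> hP.
have [r rE] := horner_meval P (fun k => match enum_val k with inl i => A i | inr i => B i end).
exists r => t AB0; rewrite -(form_eval_of_hcoord hP AB0) rE.
by rewrite (_ : P.@[_] = P.@[fun k => match enum_val k with inl i => (A i).[t] | inr i => (B i).[t] end])
  //; apply: meval_eq => k; case: (enum_val k).
Qed.

End Curves.

Section Smoothing.
Variables (K : closedFieldType) (n : nat) (C : stable_curve K n).
Implicit Types (v w : sc_comp C) (i j : 'I_n).

(** A second vector that completes [hcoord x] to a basis of the plane. *)
Definition transversal (x : P1 K) : K * K := if x is Some _ then (1, 0) else (0, 1).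

Lemma hbr_transversal (x : P1 K) : hbr (hcoord x) (transversal x) != 0.
Proof.
by case: x => [a|]; rewrite /hbr /= ?mulr0 ?mul0r ?mulr1 ?subr0 ?sub0r ?oppr_eq0 oner_neq0.
Qed.

(* The plumbing of two components at a node: for t <> 0 an isomorphism between
   them, which for t = 0 contracts the second one to the node of the first. *)
Definition plumb v w (u : {poly K} * {poly K}) : {poly K} * {poly K} :=
  let a := const_pair (hcoord (sc_node v w)) in
  let a' := const_pair (transversal (sc_node v w)) in
  let b := const_pair (hcoord (sc_node w v)) in
  let b' := const_pair (transversal (sc_node w v)) in
  (hbr b u * a.1 + 'X * hbr u b' * a'.1, hbr b u * a.2 + 'X * hbr u b' * a'.2).

(** Up to sign the determinant of [plumb v w], and by [plumbK] also the scalar by which the two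
    opposite plumbings compose. *)
Definition plumb_det v w : {poly K} :=
  let a := const_pair (hcoord (sc_node v w)) in
  let a' := const_pair (transversal (sc_node v w)) in
  let b := const_pair (hcoord (sc_node w v)) in
  let b' := const_pair (transversal (sc_node w v)) in
  'X * hbr a a' * hbr b b'.

Lemma plumb_det_neq0 v w t : t != 0 -> (plumb_det v w).[t] != 0.
Proof.
by move=> t0; rewrite !hornerM hornerX -!hbr_ev !ev_const !mulf_neq0 ?hbr_transversal.
Qed.

Lemma hbr_plumb v w u u' : hbr (plumb v w u) (plumb v w u') = - plumb_det v w * hbr u u'.
Proof.
rewrite /plumb /plumb_det /hbr.
move: (const_pair _) (const_pair _) (const_pair _) (const_pair _) => a b a' b' /=.
by ring.
Qed.

Lemma plumbK v w u :
  plumb v w (plumb w v u) = (plumb_det v w * u.1, plumb_det v w * u.2).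
Proof.
rewrite /plumb /plumb_det /hbr.
move: (const_pair _) (const_pair _) (const_pair _) (const_pair _) => a b a' b' /=.
by congr pair; ring.
Qed.

Fixpoint plumb_path v p u := if p is w :: p' then plumb v w (plumb_path w p' u) else u.

Fact tree_path_sig v w :
  exists p, [&& path (@sc_adj _ _ C) v p, uniq (v :: p) & last v p == w].
Proof.
by have [p [h1 h2 h3]] := tree_path (sc_tree C) v w; exists p; rewrite h1 h2 h3 eqxx.
Qed.

Definition tree_geodesic v w := xchoose (tree_path_sig v w).

Lemma tree_geodesicP v w : [/\ path (@sc_adj _ _ C) v (tree_geodesic v w),
  uniq (v :: tree_geodesic v w) & last v (tree_geodesic v w) = w].
Proof. by have /and3P [h1 h2 /eqP h3] := xchooseP (tree_path_sig v w). Qed.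

(** The i-th marked point of the smoothed curve in the coordinate of the component [v], with
    coordinates that are polynomials in the smoothing parameter. *)
Definition plumbed v i : {poly K} * {poly K} :=
  plumb_path v (tree_geodesic v (sc_mark_comp C i)) (const_pair (hcoord (sc_mark C i))).

(** At [t = 0] a plumbing contracts everything to the node, unless the transported point is itself
    the opposite node, where the value would be zero. This does not happen: a simple path does not
    turn back, nodes of a component are distinct, and marks are not nodes. *)
Lemma plumbed_at0 v i x : projects_to v i x ->
  exists2 l : K, l != 0 & ev_pair 0 (plumbed v i) = (l * (hcoord x).1, l * (hcoord x).2).
Proof.
move=> vx; rewrite /plumbed; have [] := tree_geodesicP v (sc_mark_comp C i).
move: (tree_geodesic _ _) => p; elim: p v x vx => [|w p IH] v x vx pP uP lP /=.
  rewrite (projects_to_eq vx (x' := sc_mark C i)); last by left.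
  by exists 1; rewrite ?oner_neq0 // ev_const !mul1r; case: (hcoord _).
rewrite (projects_to_eq vx (x' := sc_node v w)); last by right; exists w, p.
have [x' wx'] := projects_to_ex w i.
have [/= vw pP'] := andP pP; have uP' : uniq (w :: p) by case/andP: uP.
have [l l0 lE] := IH w x' wx' pP' uP' lP.
have wv : sc_adj w v by case: (sc_tree C) => -> _ _.
set u := plumb_path _ _ _ in lE *.
have bE : (hbr (const_pair (hcoord (sc_node w v))) u).[0] = l * bracket (sc_node w v) x'.
  by rewrite -hbr_ev ev_const lE /hbr /bracket /=; ring.
exists (l * bracket (sc_node w v) x').
  rewrite mulf_neq0 // bracket_eq0; apply/negP => /eqP E.
  case: p lP pP uP {IH pP' uP' lE bE} @u => [|w' p] lP pP uP u.
    move: E; rewrite (projects_to_eq wx' (x' := sc_mark C i)); last by left.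
    by move/esym; rewrite /= in lP; subst w; apply: sc_mark_smooth.
  have [/= ww' _] : sc_adj w w' /\ True by move: pP => /= /and3P [].
  have wx'' : projects_to w i (sc_node w w').
    by right; exists w', p; split=> //; [move: pP => /andP []|move: uP => /andP []].
  rewrite (projects_to_eq wx' wx'') in E.
  have vw' := sc_node_inj wv ww' E.
  by move: uP; rewrite /= vw' !inE eqxx orbT.
by congr pair; rewrite hornerD !hornerM hornerX !hornerC bE !mul0r addr0.
Qed.

(** [plumb v w] carries the configuration seen from [w] to that seen from [v]: exactly when the path
    from [w] to the mark avoids [v], and up to the factor of [plumbK] when it starts with [v]. *)
Lemma plumbed_adj v w t : t != 0 -> sc_adj v w ->
  proj_equiv (fun i => ev_pair t (plumbed v i)) (fun i => ev_pair t (plumbed w i)).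
Proof.
move=> t0 vw; set dt := (plumb_det v w).[t].
have dt0 : dt != 0 by apply: plumb_det_neq0.
have key i : exists s : K, s != 0 /\ ev_pair t (plumb v w (plumbed w i)) =
    (s * (ev_pair t (plumbed v i)).1, s * (ev_pair t (plumbed v i)).2).
  have [pP uP lP] := tree_geodesicP w (sc_mark_comp C i).
  have [pP' uP' lP'] := tree_geodesicP v (sc_mark_comp C i).
  have [[h1 h2]|[p' pE]] := tree_adj_path (sc_tree C) vw pP uP.
    exists 1; rewrite oner_neq0; split=> //; rewrite !mul1r /plumbed.
    by rewrite (tree_path_eq (sc_tree C) pP' uP' h1 h2) ?lP' //= lP.
  exists dt; split=> //.
  have -> : plumbed w i = plumb w v (plumbed v i); last by rewrite plumbK; congr pair; rewrite hornerM.
  rewrite /plumbed pE /=; congr (plumb _ _ (plumb_path _ _ _)).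
  move: pP uP lP; rewrite pE => /andP [_ pP] /andP [_ uP] lP.
  by apply: (tree_path_eq (sc_tree C) pP uP pP' uP'); rewrite lP' -lP.
have /fin_all_exists [s sP] := key.
exists (- dt), (fun i => (s i)^-1); split=> [|i|i j]; first by rewrite oppr_eq0.
  by rewrite invr_eq0; case: (sP i).
have [si0 siE] := sP i; have [sj0 sjE] := sP j.
have : hbr (ev_pair t (plumb v w (plumbed w i))) (ev_pair t (plumb v w (plumbed w j)))
    = - dt * hbr (ev_pair t (plumbed w i)) (ev_pair t (plumbed w j)).
  by rewrite !hbr_ev hbr_plumb hornerM hornerN.
have -> : hbr (ev_pair t (plumb v w (plumbed w i))) (ev_pair t (plumb v w (plumbed w j)))
    = s i * s j * hbr (ev_pair t (plumbed v i)) (ev_pair t (plumbed v j)).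
  by rewrite siE sjE /hbr /=; ring.
move=> E; apply: (mulfI (mulf_neq0 si0 sj0)); rewrite E; field; exact/andP.
Qed.

Lemma plumbed_equiv v w t : t != 0 ->
  proj_equiv (fun i => ev_pair t (plumbed v i)) (fun i => ev_pair t (plumbed w i)).
Proof.
move=> t0; have [p [pP _ <-]] := tree_path (sc_tree C) v w.
elim: p v pP => [|u p IH] v /=; first by move=> _; apply: proj_equiv_refl.
by case/andP => vu pP; apply: proj_equiv_trans (plumbed_adj t0 vu) (IH u pP).
Qed.

(** On the component that carries the mark [i], this mark differs at [t = 0] from the projection of
    every other one. The equivalence of components for [t <> 0] moves this to [v]. *)
Lemma plumbed_hbr_neq0 v i j : i != j -> hbr (plumbed v i) (plumbed v j) != 0.
Proof.
move=> ij; pose w := sc_mark_comp C i.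
have wi : projects_to w i (sc_mark C i) by left.
have [x' wj] := projects_to_ex w j.
have xx' : sc_mark C i != x'.
  apply/eqP => E; case: wj => [[jw x'E]|[w' [p [/= /andP [ww' _] _ _ x'E]]]].
    by move/eqP: ij; apply; apply: (sc_mark_inj (s := C)); rewrite ?jw // -x'E E.
  by apply: (sc_mark_smooth (s := C) ww'); rewrite -/w -x'E E.
have h0 : hbr (plumbed w i) (plumbed w j) != 0.
  apply/eqP => h; have := hbr_ev 0 (plumbed w i) (plumbed w j); rewrite h horner0.
  have [l l0 ->] := plumbed_at0 wi; have [l' l'0 ->] := plumbed_at0 wj.
  move/eqP; rewrite (_ : hbr _ _ = l * l' * bracket (sc_mark C i) x').
    by rewrite !mulf_eq0 (negbTE l0) (negbTE l'0) bracket_eq0 (negbTE xx').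
  by rewrite /hbr /bracket /=; ring.
(* The factor ['X] provides a parameter other than 0, as the comparison of components requires. *)
have [t] : exists t, ('X * hbr (plumbed w i) (plumbed w j)).[t] != 0.
  by apply: poly_nonroot; rewrite mulf_neq0 ?polyX_eq0.
rewrite hornerM hornerX mulf_eq0 negb_or => /andP [t0 ht].
have [k [s [k0 s0 E]]] := plumbed_equiv v w t0.
apply/eqP => h; move: (E i j); rewrite !hbr_ev h horner0 => /esym/eqP.
by rewrite !mulf_eq0 (negbTE k0) !(negbTE (s0 _)) (negbTE ht).
Qed.

(** At [t = 0] the cross-ratio of [q] has to be read on its own component [v q]. For [t <> 0] all
    components give equivalent configurations, so that one smooth curve accounts for all
    quadruples. *)
Lemma smoothing (c : P1pow K (quad n)) d (R : form K (quad n)) :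
    has_cross_ratios C c -> multihom d R -> form_eval R c != 0 ->
  exists2 X, independent X & form_eval R (cross_ratios X) != 0.
Proof.
move=> Cc hR Rc.
have /fin_all_exists [v vP] := Cc; have /fin_all_exists [y yP] := vP.
pose A q := cr_num (plumbed (v q)) q; pose B q := cr_den (plumbed (v q)) q.
have [r rE] := form_curve A B hR.
have AB0 q : exists2 l, l != 0 & ((A q).[0], (B q).[0]) =
    (l * (bracket (y q (inord 0)) (y q (inord 2)) * bracket (y q (inord 1)) (y q (inord 3))),
     l * (bracket (y q (inord 0)) (y q (inord 3)) * bracket (y q (inord 1)) (y q (inord 2)))).
  have [yq _ _] := yP q.
  have [l0 n0 E0] := plumbed_at0 (yq (inord 0)); have [l1 n1 E1] := plumbed_at0 (yq (inord 1)).
  have [l2 n2 E2] := plumbed_at0 (yq (inord 2)); have [l3 n3 E3] := plumbed_at0 (yq (inord 3)).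
  exists (l0 * l1 * l2 * l3); first by rewrite !mulf_neq0.
  rewrite -cr_num_ev -cr_den_ev /cr_num /cr_den E0 E1 E2 E3 /hbr /bracket /=.
  by congr pair; ring.
have num_den0 q : (bracket (y q (inord 0)) (y q (inord 2)) * bracket (y q (inord 1)) (y q (inord 3)),
     bracket (y q (inord 0)) (y q (inord 3)) * bracket (y q (inord 1)) (y q (inord 2))) != (0, 0).
  have [_ y3 _] := yP q; rewrite -pair_eqE /= !mulf_eq0 !bracket_eq0.
  have n3 a b c' : uniq [:: a; b; c'] -> ~ (y q a = y q b /\ y q b = y q c') := @y3 a b c'.
  apply/negP => /andP [/orP [] /eqP E /orP [] /eqP E'].
  - by case: (n3 (inord 2) (inord 0) (inord 3)); [rewrite /= !inE -!val_eqE /= !inordK|split; congruence].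
  - by case: (n3 (inord 0) (inord 2) (inord 1)); [rewrite /= !inE -!val_eqE /= !inordK|split; congruence].
  - by case: (n3 (inord 0) (inord 3) (inord 1)); [rewrite /= !inE -!val_eqE /= !inordK|split; congruence].
  - by case: (n3 (inord 3) (inord 1) (inord 2)); [rewrite /= !inE -!val_eqE /= !inordK|split; congruence].
have r0 : r.[0] != 0.
  rewrite rE => [|q]; last first.
    have [l l0 ->] := AB0 q; move: (num_den0 q); rewrite -!pair_eqE /= !(mulf_eq0 l).
    by rewrite (negbTE l0).
  rewrite (_ : [ffun q => _] = c) //; apply/ffunP => q; rewrite ffunE.
  have [l l0 [-> ->]] := AB0 q; rewrite of_hcoord_scale //.
  by have [_ _ ->] := yP q.
have /card_gt0P [v0 _] := sc_nonempty C.
pose S := [seq hbr (plumbed v0 ij.1) (plumbed v0 ij.2) | ij <- enum {: 'I_n * 'I_n} & ij.1 != ij.2].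
have [t] : exists t, (r * 'X * \prod_(p <- S) p).[t] != 0.
  apply: poly_nonroot; rewrite !mulf_neq0 ?polyX_eq0 //.
    by apply: contraNneq r0 => ->; rewrite horner0.
  rewrite prodf_seq_neq0; apply/allP => p /mapP [[i j]]; rewrite mem_filter => /andP [ij _] ->.
  exact: plumbed_hbr_neq0.
rewrite !hornerM hornerX !mulf_eq0 !negb_or horner_prod => /andP [/andP [rt t0] St].
have iX : independent (fun i => ev_pair t (plumbed v0 i)).
  move=> i j ij; rewrite hbr_ev; move: St; rewrite prodf_seq_neq0 => /allP /(_ (hbr (plumbed v0 i) (plumbed v0 j))).
  by apply; apply/mapP; exists (i, j) => //; rewrite mem_filter ij mem_enum.
exists (fun i => ev_pair t (plumbed v0 i)) => //.
have iXq q : independent (fun i => ev_pair t (plumbed (v q) i)).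
  exact: proj_equiv_independent (plumbed_equiv _ v0 t0) iX.
move: rt; rewrite rE => [|q].
  rewrite (_ : [ffun q => _] = cross_ratios (fun i => ev_pair t (plumbed v0 i))) //.
  apply/ffunP => q; rewrite (proj_equiv_cross_ratio q (plumbed_equiv v0 (v q) t0)) !ffunE.
  by rewrite cr_num_ev cr_den_ev.
by rewrite -cr_num_ev -cr_den_ev -pair_eqE /= (negbTE (cr_num_neq0 q (iXq q))).
Qed.

End Smoothing.

(** * Density of principal open sets *)

Section Density.
Variables (K : closedFieldType) (n : nat).

(* Two generic configurations are joined by a line of configurations. *)
Lemma Mbar_dense (D W : P1pow K (quad n) -> Prop) X0 : principal D ->
    independent X0 -> D (cross_ratios X0) -> zopen (@Mbar K n) W -> (exists c, W c) ->
  exists X, [/\ independent X, D (cross_ratios X) & (3 <= n)%N -> W (cross_ratios X)].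
Proof.
move=> [d [T [hT DT]]] iX0 /DT T0 [WM Wopen] [c Wc].
have [d' [R [hR Rc RW]]] := Wopen c Wc; have [C Cc] := WM c Wc.
have [X1 iX1 R1] := smoothing Cc hR Rc.
pose L i : {poly K} * {poly K} :=
  ((X0 i).1%:P + ((X1 i).1 - (X0 i).1) *: 'X, (X0 i).2%:P + ((X1 i).2 - (X0 i).2) *: 'X).
have L0 i : ev_pair 0 (L i) = X0 i.
  by rewrite [RHS]surjective_pairing; congr pair; rewrite hornerD hornerZ hornerX hornerC; ring.
have L1 i : ev_pair 1 (L i) = X1 i.
  by rewrite [RHS]surjective_pairing; congr pair; rewrite hornerD hornerZ hornerX hornerC; ring.
have curve (e : quad n -> nat) (P : form K (quad n)) : multihom e P ->
    exists r : {poly K}, forall t X, (forall i, ev_pair t (L i) = X i) -> independent X ->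
      (r.[t] != 0) = (form_eval P (cross_ratios X) != 0).
  move=> hP; have [r rE] := form_curve (cr_num L) (cr_den L) hP.
  exists r => t X LX iX.
  have numE q : (cr_num L q).[t] = cr_num X q by rewrite -cr_num_ev /cr_num !LX.
  have denE q : (cr_den L q).[t] = cr_den X q by rewrite -cr_den_ev /cr_den !LX.
  rewrite rE => [|q]; last by rewrite numE -pair_eqE /= (negbTE (cr_num_neq0 q iX)).
  by congr (form_eval _ _ != 0); apply/ffunP => q; rewrite !ffunE numE denE.
have [rT rTE] := curve _ _ hT; have [rR rRE] := curve _ _ hR.
pose S := [seq hbr (L ij.1) (L ij.2) | ij <- enum {: 'I_n * 'I_n} & ij.1 != ij.2].
(* None of the factors is the zero polynomial: [rT] and the brackets are nonzero at 0, where the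
   line passes through [X0], and [rR] is nonzero at 1, where it passes through [X1]. *)
have [t] : exists t, (rT * rR * \prod_(p <- S) p).[t] != 0.
  apply: poly_nonroot; rewrite !mulf_neq0 //.
  - by move: T0; rewrite -(rTE 0 X0) //; apply: contraNneq => ->; rewrite horner0.
  - by move: R1; rewrite -(rRE 1 X1) //; apply: contraNneq => ->; rewrite horner0.
  rewrite prodf_seq_neq0; apply/allP => p /mapP [[i j]]; rewrite mem_filter => /andP [ij _] ->.
  by move: (iX0 i j ij); rewrite -!L0 hbr_ev; apply: contraNneq => /= ->; rewrite horner0.
rewrite !hornerM !mulf_eq0 !negb_or horner_prod => /andP [/andP [Tt Rt] St].
pose X i := ev_pair t (L i).
have iX : independent X.
  move=> i j ij; rewrite hbr_ev; move: St; rewrite prodf_seq_neq0 => /allP /(_ (hbr (L i) (L j))).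
  by apply; apply/mapP; exists (i, j) => //; rewrite mem_filter ij mem_enum.
exists X; split=> //; first by apply/DT; rewrite -(rTE t).
by move=> n3; apply: RW; [exact: Mbar_cross_ratios|rewrite -(rRE t)].
Qed.

(** The line from a point of [D] to a point of [W] meets both open sets outside the roots of a
    nonzero polynomial. *)
Lemma affine_dense N (D : P1pow K 'I_N -> Prop) : principal D -> (exists x, affine_pt x /\ D x) ->
  zdense (@affine_pt K N) (fun x => affine_pt x /\ D x).
Proof.
move=> [d [T [hT DT]]] [x [xA /DT Tx]] W [WA Wopen] [y Wy].
have [d' [R [hR Ry RW]]] := Wopen y Wy; have yA := WA y Wy.
have affE (z : P1pow K 'I_N) i : affine_pt z -> z i = Some (odflt 0 (z i)).
  by move=> /(_ i); case: (z i).
pose L i : {poly K} := (odflt 0 (x i))%:P + (odflt 0 (y i) - odflt 0 (x i)) *: 'X.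
have L0 i : (L i).[0] = odflt 0 (x i) by rewrite hornerD hornerZ hornerX hornerC; ring.
have L1 i : (L i).[1] = odflt 0 (y i) by rewrite hornerD hornerZ hornerX hornerC; ring.
have curve (e : 'I_N -> nat) (P : form K 'I_N) : multihom e P ->
    exists r : {poly K}, forall t z, affine_pt z -> (forall i, (L i).[t] = odflt 0 (z i)) ->
      (r.[t] != 0) = (form_eval P z != 0).
  move=> hP; have [r rE] := form_curve L (fun=> 1) hP.
  exists r => t z zA Lz; rewrite rE => [|i]; last by rewrite -pair_eqE /= hornerC oner_eq0 andbF.
  congr (form_eval _ _ != 0); apply/ffunP => i; rewrite !ffunE hornerC /of_hcoord oner_eq0.
  by rewrite divr1 Lz -affE.
have [rT rTE] := curve _ _ hT; have [rR rRE] := curve _ _ hR.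
have [t] : exists t, (rT * rR).[t] != 0.
  apply: poly_nonroot; rewrite mulf_neq0 //.
  - by move: Tx; rewrite -(rTE 0 x) //; apply: contraNneq => ->; rewrite horner0.
  - by move: Ry; rewrite -(rRE 1 y) //; apply: contraNneq => ->; rewrite horner0.
rewrite hornerM mulf_eq0 negb_or => /andP [Tt Rt].
pose z : P1pow K 'I_N := [ffun i => Some (L i).[t]].
have zA : affine_pt z by move=> i; rewrite ffunE.
have Lz i : (L i).[t] = odflt 0 (z i) by rewrite ffunE.
exists z; split; first by apply: RW => //; rewrite -(rRE t).
by split=> //; apply/DT; rewrite -(rTE t).
Qed.

End Density.

(** * Maximal minors and Moebius transformations *)

Section Minors.
Variable K : fieldType.

(** The generalised cross product of the rows: a kernel vector that is polynomial in the entries of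
    the matrix. *)
Definition minors n (M : 'M[K]_(n.-1, n)) (j : 'I_n) : K := (-1) ^+ j * \det (col' j M).

Lemma sum_lift n (f : 'I_n -> K) (j : 'I_n) :
  \sum_k f k = f j + \sum_(k < n.-1) f (lift j k).
Proof. by rewrite (bigD1_ord j). Qed.

Lemma minors_ker n (M : 'M[K]_(n.-1, n)) i : \sum_j M i j * minors M j = 0.
Proof.
case: n M i => [|n] M i; first by rewrite big_ord0.
rewrite /= in M i *.
(* The sum is the expansion along the first row of a determinant in which row [i] is repeated. *)
pose N : 'M[K]_(1 + n) := col_mx (row i M) M.
have dN : \det N = 0.
  apply: (@determinant_alternate _ _ N (lshift n ord0) (rshift 1 i)).
    by rewrite -val_eqE.
  by move=> j; rewrite col_mxEu col_mxEd mxE.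
rewrite -[RHS]dN (expand_det_row N (lshift n ord0)); apply: eq_bigr => j _.
rewrite col_mxEu mxE /minors /cofactor /= add0n; congr (_ * (_ * \det _)).
apply/matrixP => k l; rewrite !mxE.
have -> : lift (@lshift 1 n ord0) k = @rshift 1 n k by apply: val_inj.
by case: splitP => i2 E; [case: i2 E => -[]|congr (M _ _); apply: ord_inj; move: E => /= []].
Qed.

Definition in_ker n (M : 'M[K]_(n.-1, n)) (v : 'I_n -> K) : Prop :=
  forall i, \sum_j M i j * v j = 0.

Lemma in_ker_vanish n (M : 'M[K]_(n.-1, n)) v j0 : minors M j0 != 0 ->
  in_ker M v -> v j0 = 0 -> forall j, v j = 0.
Proof.
rewrite mulf_eq0 negb_or => /andP [_ dM] vM v0 j.
pose u : 'cV[K]_(n.-1) := \col_k v (lift j0 k).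
have uM : col' j0 M *m u = 0.
  apply/matrixP => i l; rewrite !mxE -[RHS](vM i) (sum_lift _ j0) v0 mulr0 add0r.
  by apply: eq_bigr => k _; rewrite !mxE.
have u0 : u = 0.
  have uA : col' j0 M \in unitmx by rewrite unitmxE unitfE.
  by rewrite -(mulKmx uA u) uM mulmx0.
case: (unliftP j0 j) => [k ->|-> //].
by move/matrixP/(_ k 0): u0; rewrite !mxE.
Qed.

Lemma minors_span n (M : 'M[K]_(n.-1, n)) v j0 : minors M j0 != 0 -> in_ker M v ->
  forall j, v j = v j0 / minors M j0 * minors M j.
Proof.
move=> m0 vM j; apply/eqP; rewrite -subr_eq0; apply/eqP.
apply: (@in_ker_vanish _ M (fun j => v j - v j0 / minors M j0 * minors M j) j0) => //; last first.
  by rewrite divfK // subrr.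
move=> i; under eq_bigr do rewrite mulrBr [M i _ * (_ * _)]mulrCA.
by rewrite sumrB vM -mulr_sumr minors_ker mulr0 subrr.
Qed.

(** If the minor vanished, a kernel vector of the truncated matrix, extended by 0 at [j0], would be
    a nonzero element of the kernel; but a multiple of [v] that vanishes at [j0] is zero. *)
Lemma minors_neq0 n (M : 'M[K]_(n.-1, n)) v j0 : v j0 != 0 ->
  (forall u, in_ker M u -> exists c, forall j, u j = c * v j) -> minors M j0 != 0.
Proof.
move=> v0 vM; rewrite mulf_neq0 ?signr_eq0 //; apply/negP => /eqP dM.
have /det0P [u u0 uM] : \det (col' j0 M)^T == 0 by rewrite det_tr dM.
pose w j := if unlift j0 j is Some k then u 0 k else 0.
have wM : in_ker M w.
  move=> i; rewrite (sum_lift _ j0) /w unlift_none mulr0 add0r.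
  have /matrixP /(_ 0 i) := uM; rewrite !mxE => uMi; rewrite -[RHS]uMi.
  by apply: eq_bigr => k _; rewrite liftK !mxE mulrC.
have [c cE] := vM _ wM.
have c0 : c = 0.
  by apply/eqP; have /esym/eqP := cE j0; rewrite /w unlift_none mulf_eq0 (negbTE v0) orbF.
case/eqP: u0; apply/rowP => k; rewrite mxE; have := cE (lift j0 k).
by rewrite /w liftK c0 mul0r.
Qed.

End Minors.

Section Moebius.
Variables (K : fieldType) (n : nat).
Implicit Types (X Y : 'I_n -> K * K).

Definition moebius (G : (K * K) * (K * K)) (u : K * K) : K * K :=
  (G.1.1 * u.1 + G.1.2 * u.2, G.2.1 * u.1 + G.2.2 * u.2).

Definition scale_pair (s : K) (u : K * K) : K * K := (s * u.1, s * u.2).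

(** Unlike [proj_equiv] this retains the matrix, which also acts on the pair of interpolants. *)
Definition moebius_equiv Y X G (s : 'I_n -> K) : Prop :=
  [/\ hbr G.1 G.2 != 0, forall i, s i != 0
    & forall i, Y i = scale_pair (s i) (moebius G (X i))].

Lemma moebius_proj_equiv Y X G s : moebius_equiv Y X G s -> proj_equiv Y X.
Proof.
move=> [G0 s0 E]; exists (hbr G.1 G.2), s; split=> // i j.
by rewrite !E /hbr /moebius /=; ring.
Qed.

End Moebius.

Section Frame.
Variables (K : fieldType) (n' : nat).
Let n := n'.+3.
Implicit Types (X Y : 'I_n -> K * K) (c : P1pow K (quad n)).

Definition pt0 : 'I_n := @Ordinal n 0 isT.
Definition pt1 : 'I_n := @Ordinal n 1 isT.
Definition pt2 : 'I_n := @Ordinal n 2 isT.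

(** The default value of [nth] supplies [i] as the fourth entry, and [insub] fails exactly when [i]
    is one of the three base points. *)
Definition base_quad (i : 'I_n) : option (quad n) :=
  insub [ffun k : 'I_4 => nth i [:: pt0; pt1; pt2] k].

(* The affine coordinate of the i-th point, for i != pt0, once the first three
   points have been moved to oo, 0 and 1. *)
Definition frame_coord c (i : 'I_n) : K :=
  if base_quad i is Some q then odflt 0 (c q) else (i == pt2)%:R.

Definition frame c (i : 'I_n) : K * K :=
  if i == pt0 then (1, 0) else (frame_coord c i, 1).

Lemma base_quadP i : if base_quad i is Some q
  then [/\ q (inord 0) = pt0, q (inord 1) = pt1, q (inord 2) = pt2 & q (inord 3) = i]
  else i \in [:: pt0; pt1; pt2].
Proof.
rewrite /base_quad; case: insubP => [q _ qE|].
  have E k : q k = nth i [:: pt0; pt1; pt2] k.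
    by rewrite -[LHS]/(quad_fun q k) -[quad_fun q]/(val q) qE ffunE.
  by rewrite !E !inordK.
apply: contraR => iN; apply/injectiveP => k l; rewrite !ffunE.
have u : uniq [:: pt0; pt1; pt2; i].
  by move: iN; rewrite /= !inE !negb_or ![_ == i]eq_sym => /and3P [-> -> ->].
have E (k' : 'I_4) : nth i [:: pt0; pt1; pt2] k' = nth i [:: pt0; pt1; pt2; i] k'.
  by case: k' => [[|[|[|[|]]]]].
by rewrite !E => /eqP; rewrite nth_uniq ?ltn_ord // => /eqP /ord_inj.
Qed.

Lemma frame_moebius X : independent X ->
  exists G s, moebius_equiv (frame (cross_ratios X)) X G s.
Proof.
move=> iX.
pose A := hbr (X pt0) (X pt2); pose B := hbr (X pt1) (X pt2).
have A0 : A != 0 by apply: iX.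
have B0 : B != 0 by apply: iX.
(* The image of [X i] is [(A * hbr (X pt1) (X i), B * hbr (X pt0) (X i))], so the three base points
   go to oo, 0 and 1. *)
pose G := ((- A * (X pt1).2, A * (X pt1).1), (- B * (X pt0).2, B * (X pt0).1)).
pose s i := if i == pt0 then (A * hbr (X pt1) (X pt0))^-1 else (B * hbr (X pt0) (X i))^-1.
have GE i : moebius G (X i) = (A * hbr (X pt1) (X i), B * hbr (X pt0) (X i)).
  by rewrite /moebius /hbr /=; congr pair; ring.
have s0 i : s i != 0.
  by rewrite /s; have [_|i0] := eqVneq i pt0; rewrite invr_eq0 mulf_neq0 // iX // eq_sym.
exists G, s; split=> // [|i].
  have -> : hbr G.1 G.2 = A * B * hbr (X pt1) (X pt0) by rewrite /hbr /=; ring.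
  by rewrite !mulf_neq0 //; apply: iX.
rewrite GE /scale_pair /frame /s /=; have [->|i0] := eqVneq i pt0.
  by rewrite mulVf ?mulf_neq0 ?iX // (_ : hbr (X pt0) (X pt0) = 0) ?mulr0 // /hbr; ring.
have C0 : hbr (X pt0) (X i) != 0 by apply: iX; rewrite eq_sym.
rewrite mulVf ?mulf_neq0 //; congr (_, _); rewrite /frame_coord.
have := base_quadP i; case: (base_quad i) => [q [q0 q1 q2 q3]|].
  rewrite cross_ratiosE // /cr_num /cr_den q0 q1 q2 q3 /= -/A -/B.
  by rewrite mulrC [B * _]mulrC.
rewrite !inE (negbTE i0) /= => /orP [] /eqP ->.
  by rewrite (_ : hbr (X pt1) (X pt1) = 0) ?mulr0 // /hbr; ring.
by rewrite eqxx -/A -/B [A * B]mulrC mulVf ?mulf_neq0.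
Qed.

End Frame.

(** * Planes in the space of interpolants *)

(* [inl false] and [inl true] label the two pivots of the row echelon basis of a
   2-plane in K^(r + 2). *)
Notation label r := (bool + 'I_r)%type.
Notation pivot0 := (inl false).
Notation pivot1 := (inl true).

(** Derives an equation from [a = b] once the cofactor [k] is known; what remains is left to
    [ring]. *)
Lemma eq_of_multiple (R : comNzRingType) (k a b x y : R) :
  a = b -> x - y = k * (a - b) -> x = y.
Proof. by move=> ->; rewrite subrr mulr0 => /eqP; rewrite subr_eq0 => /eqP. Qed.

Section Parametrization.
Variables (K : fieldType) (n' r : nat).
Let n := n'.+3.
(** [codom e] is the set S; its index type has one element fewer than there are coefficients in a
    pair of interpolants. [ell l i] is the value of the basis function [l] at the i-th parameter,
    and [B] is the linear substitution for the labels outside S, with inverse [B']. *)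
Variable e : 'I_(#|{: label r + label r}|.-1) -> 'I_n.
Variable ell : label r -> 'I_n -> K.
Let T : finType := {i : 'I_n | i \notin codom e}.
Variables (B : 'I_n -> T -> K) (B' : T -> T -> K).
Hypothesis BK : forall i l : T, \sum_j B (val i) j * B' j l = (i == l)%:R.
Hypothesis B'K : forall i l : T, \sum_j B' i j * B (val j) l = (i == l)%:R.

Definition param_idx : finType := (('I_r + 'I_r) + T)%type.
Implicit Types (a : param_idx -> K) (Y X : 'I_n -> K * K) (u v : label r -> K).

Definition comb u (i : 'I_n) : K := \sum_l u l * ell l i.

Definition alpha a (l : label r) : K :=
  match l with inl b => (~~ b)%:R | inr j => a (inl (inl j)) end.
Definition beta a (l : label r) : K :=
  match l with inl b => b%:R | inr j => a (inl (inr j)) end.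

Definition cfg a (i : 'I_n) : K * K :=
  if i \in codom e then (comb (alpha a) i, comb (beta a) i)
  else (\sum_(j : T) B i j * a (inr j), 1).

(* The rational map (u : v) either takes the value Y i at the i-th parameter or
   has a base point there. *)
Definition interpolates Y u v : Prop :=
  forall i, i \in codom e -> comb u i * (Y i).2 = comb v i * (Y i).1.

Definition interp_mx Y : 'M[K]_(#|{: label r + label r}|.-1, #|{: label r + label r}|) :=
  \matrix_(i, j) match enum_val j with
    | inl l => ell l (e i) * (Y (e i)).2
    | inr l => - (ell l (e i) * (Y (e i)).1)
    end.

Definition sol Y (l : label r + label r) : K := minors (interp_mx Y) (enum_rank l).
Definition num_sol Y (l : label r) : K := sol Y (inl l).
Definition den_sol Y (l : label r) : K := sol Y (inr l).

Definition join_vec u v (j : 'I_(#|{: label r + label r}|)) : K :=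
  match enum_val j with inl l => u l | inr l => v l end.

Lemma join_vec_rank u v s :
  join_vec u v (enum_rank s) = match s with inl l => u l | inr l => v l end.
Proof. by rewrite /join_vec enum_rankK. Qed.

Lemma in_ker_interp Y u v : in_ker (interp_mx Y) (join_vec u v) <-> interpolates Y u v.
Proof.
have sumE i : \sum_j interp_mx Y i j * join_vec u v j =
    comb u (e i) * (Y (e i)).2 - comb v (e i) * (Y (e i)).1.
  rewrite (reindex (@enum_rank (label r + label r)%type)) /=; last first.
    by exists enum_val => k _; [exact: enum_rankK|exact: enum_valK].
  rewrite big_sumType /= /comb !mulr_suml -sumrN.
  by congr (_ + _); apply: eq_bigr => l _; rewrite mxE join_vec_rank enum_rankK; ring.
split=> [h i /codomP [k ->]|h i].
  by apply/eqP; rewrite -subr_eq0 -sumE h.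
by rewrite sumE h ?subrr // codom_f.
Qed.

Lemma in_ker_join Y (w : 'I_(#|{: label r + label r}|) -> K) : in_ker (interp_mx Y) w ->
  interpolates Y (fun l => w (enum_rank (inl l : label r + label r)))
    (fun l => w (enum_rank (inr l : label r + label r))).
Proof.
move=> wK; apply/in_ker_interp => i; rewrite -[RHS](wK i); apply: eq_bigr => j _.
by rewrite /join_vec; congr (_ * _); case E: (enum_val j) => [l|l]; rewrite -E enum_valK.
Qed.

Lemma sol_interpolates Y : interpolates Y (num_sol Y) (den_sol Y).
Proof. by apply: in_ker_join => i; apply: minors_ker. Qed.

Lemma sol_span Y u v s : sol Y s != 0 -> interpolates Y u v ->
  exists c, u =1 (fun l => c * num_sol Y l) /\ v =1 (fun l => c * den_sol Y l).
Proof.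
move=> s0 /in_ker_interp uv; exists (join_vec u v (enum_rank s) / sol Y s).
split=> l; first by have := minors_span s0 uv (enum_rank (inl l)); rewrite [LHS]join_vec_rank.
by have := minors_span s0 uv (enum_rank (inr l)); rewrite [LHS]join_vec_rank.
Qed.

Lemma sol_neq0 Y u v s : join_vec u v (enum_rank s) != 0 ->
  (forall u' v', interpolates Y u' v' ->
     exists c, u' =1 (fun l => c * u l) /\ v' =1 (fun l => c * v l)) ->
  sol Y s != 0.
Proof.
move=> s0 h; apply: (minors_neq0 s0) => w wK.
have [c [uE vE]] := h _ _ (in_ker_join wK); exists c => j.
by rewrite /join_vec -[in LHS](enum_valK j); case: (enum_val j) => l.
Qed.

Lemma combD c1 c2 u v i :
  comb (fun l => c1 * u l + c2 * v l) i = c1 * comb u i + c2 * comb v i.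
Proof.
by rewrite /comb !mulr_sumr -big_split; apply: eq_bigr => l _; rewrite /=; ring.
Qed.

Lemma combZ c u i : comb (fun l => c * u l) i = c * comb u i.
Proof. by rewrite /comb mulr_sumr; apply: eq_bigr => l _; rewrite mulrA. Qed.

Lemma eq_comb u v i : u =1 v -> comb u i = comb v i.
Proof. by move=> uv; apply: eq_bigr => l _; rewrite uv. Qed.

Lemma cfg_interpolates a : interpolates (cfg a) (alpha a) (beta a).
Proof. by move=> i iS; rewrite /cfg iS /= mulrC. Qed.

Lemma interpolates_moebius Y X G s u v : moebius_equiv Y X G s ->
  interpolates X u v ->
  interpolates Y (fun l => G.1.1 * u l + G.1.2 * v l) (fun l => G.2.1 * u l + G.2.2 * v l).
Proof.
move=> [G0 s0 E] uv i iS; have := uv i iS; rewrite !combD E /= => uvE.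
by apply: (eq_of_multiple (k := s i * hbr G.1 G.2) uvE); rewrite /hbr; ring.
Qed.

Lemma moebius_interpolates Y X G s u v : moebius_equiv Y X G s ->
  interpolates Y (fun l => G.1.1 * u l + G.1.2 * v l) (fun l => G.2.1 * u l + G.2.2 * v l) ->
  interpolates X u v.
Proof.
move=> [G0 s0 E] uv i iS; have := uv i iS; rewrite !combD E /= => uvE.
apply: (mulfI (s0 i)); apply: (mulfI G0).
by apply: (eq_of_multiple (k := 1) uvE); rewrite /hbr; ring.
Qed.

Definition good a : Prop := independent (cfg a) /\ sol (cfg a) (inl pivot0) != 0.

(** The minor shows that the condition is open; uniqueness of the interpolant is what Moebius and
    Galois transformations respect. The minor at [pivot0] decides because [alpha a pivot0] is 1. *)
Lemma goodP a : good a <-> independent (cfg a) /\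
  (forall u v, interpolates (cfg a) u v ->
     exists c, u =1 (fun l => c * alpha a l) /\ v =1 (fun l => c * beta a l)).
Proof.
split=> -[ind h]; split=> //.
  have [c [aE bE]] := sol_span h (cfg_interpolates a).
  have c0 : c != 0.
    by apply/negP => /eqP c0; have := aE pivot0; rewrite c0 mul0r /= => /eqP; rewrite oner_eq0.
  move=> u v uv; have [d [uE vE]] := sol_span h uv; exists (d / c).
  by split=> l; rewrite ?uE ?vE ?aE ?bE mulrA divfK.
by apply: (@sol_neq0 _ (alpha a) (beta a)) => //; rewrite join_vec_rank /= oner_neq0.
Qed.

(** The determinant of the pivot columns. Its nonvanishing permits row reduction with these two
    pivots. *)
Definition frame_det Y : K :=
  num_sol Y pivot0 * den_sol Y pivot1 - num_sol Y pivot1 * den_sol Y pivot0.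

(** Together with [back_den] the adjugate of the matrix of pivot columns applied to [Y i]: the point
    in the coordinate fixed by the echelon basis. *)
Definition back_num Y i : K := den_sol Y pivot1 * (Y i).1 - num_sol Y pivot1 * (Y i).2.
Definition back_den Y i : K := num_sol Y pivot0 * (Y i).2 - den_sol Y pivot0 * (Y i).1.

Definition back Y (k : param_idx) : K :=
  match k with
  | inl (inl j) => (den_sol Y pivot1 * num_sol Y (inr j) -
                    num_sol Y pivot1 * den_sol Y (inr j)) / frame_det Y
  | inl (inr j) => (num_sol Y pivot0 * den_sol Y (inr j) -
                    den_sol Y pivot0 * num_sol Y (inr j)) / frame_det Y
  | inr t => \sum_(j : T) B' t j * (back_num Y (val j) / back_den Y (val j))
  end.

(** On S it detects base points of the interpolant: the denominator vanishes at [pt0], which sits at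
    oo, so the numerator is tested there, while elsewhere the denominator suffices. Outside S it
    keeps the point away from oo in the echelon coordinate. *)
Definition weight Y (i : 'I_n) : K :=
  if i \in codom e then
    (if i == pt0 n' then comb (num_sol Y) i else comb (den_sol Y) i)
  else back_den Y i.

Definition frame_good Y : Prop := frame_det Y != 0 /\ forall i, weight Y i != 0.

(** The interpolant of [Y] is a multiple of [G] applied to [alpha a] and [beta a]. Row reduction
    removes both [G] and the factor, so [a] is recovered from any configuration in the Moebius
    class. *)
Lemma frame_good_of_good a Y G s : good a -> moebius_equiv Y (cfg a) G s ->
    Y (pt0 n') = (1, 0) -> (forall i, i != pt0 n' -> (Y i).2 = 1) ->
  frame_good Y /\ back Y =1 a.
Proof.
move=> /goodP [ind ker] YX Y0 Y1.
have [G0 s0 YE] := YX.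
have /(_ _) solY := interpolates_moebius YX (cfg_interpolates a).
have kerY u v : interpolates Y u v -> exists c,
    u =1 (fun l => c * (G.1.1 * alpha a l + G.1.2 * beta a l)) /\
    v =1 (fun l => c * (G.2.1 * alpha a l + G.2.2 * beta a l)).
  move=> uv.
  pose u' l := (G.2.2 * u l - G.1.2 * v l) / hbr G.1 G.2.
  pose v' l := (G.1.1 * v l - G.2.1 * u l) / hbr G.1 G.2.
  have uE l : u l = G.1.1 * u' l + G.1.2 * v' l by rewrite /u' /v' /hbr; field.
  have vE l : v l = G.2.1 * u' l + G.2.2 * v' l by rewrite /u' /v' /hbr; field.
  have [|c [u'E v'E]] := ker u' v'.
    apply: (moebius_interpolates YX) => i iS.
    by rewrite -(eq_comb i uE) -(eq_comb i vE); apply: uv.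
  by exists c; split=> l; rewrite ?uE ?vE u'E v'E; ring.
(* The two entries at [pivot0] are proportional to [G.1.1] and [G.2.1], which are not both zero, but
   either one may be. *)
have [s1 s1P] : exists s1, sol Y s1 != 0.
  have [G1|G1] := eqVneq G.1.1 0.
    have G2 : G.2.1 != 0.
      by apply: contraNneq G0 => G2; rewrite /hbr G1 G2 !mul0r mulr0 subrr.
    exists (inr pivot0); apply: (@sol_neq0 _ _ _ _ _ kerY).
    by rewrite join_vec_rank /= mulr0 addr0 mulr1.
  exists (inl pivot0); apply: (@sol_neq0 _ _ _ _ _ kerY).
  by rewrite join_vec_rank /= mulr0 addr0 mulr1.
have [c [PE QE]] := kerY _ _ (sol_interpolates Y).
have c0 : c != 0.
  by apply: contraNneq s1P => c0; case: (s1) => l; [have := PE l|have := QE l];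
    rewrite c0 mul0r => h; apply/eqP.
have [P0 P1 Q0 Q1] : [/\ num_sol Y pivot0 = c * G.1.1, num_sol Y pivot1 = c * G.1.2,
    den_sol Y pivot0 = c * G.2.1 & den_sol Y pivot1 = c * G.2.2].
  by split; rewrite ?PE ?QE /= ?mulr0 ?mulr1 ?addr0 ?add0r.
have det0 : frame_det Y != 0.
  rewrite /frame_det P0 P1 Q0 Q1.
  rewrite (_ : _ - _ = c * c * hbr G.1 G.2); last by rewrite /hbr; ring.
  by rewrite !mulf_neq0.
have backE i : back_num Y i = c * s i * hbr G.1 G.2 * (cfg a i).1 /\
    back_den Y i = c * s i * hbr G.1 G.2 * (cfg a i).2.
  by rewrite /back_num /back_den P0 P1 Q0 Q1 YE /hbr /=; split; ring.
split; first split=> // i.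
  rewrite /weight; case: ifP => [iS|/negbT iS]; last first.
    by rewrite (backE i).2 /cfg (negbTE iS) /= mulr1 !mulf_neq0.
  have [combP combQ] : comb (num_sol Y) i = c / s i * (Y i).1 /\
      comb (den_sol Y) i = c / s i * (Y i).2.
    rewrite (eq_comb i PE) (eq_comb i QE) !combZ !combD YE /cfg iS /=.
    by split; field.
  by have [i0|i0] := eqVneq i (pt0 n'); rewrite ?combP ?combQ ?i0 ?Y0 ?Y1 //= mulr1 mulf_neq0 ?invr_eq0.
case=> [[j|j]|t]; rewrite /back.
- rewrite P1 Q1 PE QE /frame_det P0 P1 Q0 Q1 /=.
  have -> : c * G.1.1 * (c * G.2.2) - c * G.1.2 * (c * G.2.1) = c * c * hbr G.1 G.2.
    by rewrite /hbr; ring.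
  by apply: (canLR (mulfK _)); rewrite ?mulf_neq0 // /hbr; ring.
- rewrite P0 Q0 PE QE /frame_det P0 P1 Q0 Q1 /=.
  have -> : c * G.1.1 * (c * G.2.2) - c * G.1.2 * (c * G.2.1) = c * c * hbr G.1 G.2.
    by rewrite /hbr; ring.
  by apply: (canLR (mulfK _)); rewrite ?mulf_neq0 // /hbr; ring.
have bE (j : T) : back_num Y (val j) / back_den Y (val j) = \sum_(k : T) B (val j) k * a (inr k).
  have [-> ->] := backE (val j); rewrite /cfg (negbTE (valP j)) /= mulr1.
  by rewrite mulrC mulKf // !mulf_neq0.
under eq_bigr do rewrite bE mulr_sumr.
rewrite exchange_big /= (bigD1 t) //= [X in _ + X]big1 ?addr0 => [|k kt].
  by under eq_bigr do rewrite mulrA; rewrite -mulr_suml B'K eqxx mul1r.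
by under eq_bigr do rewrite mulrA; rewrite -mulr_suml B'K eq_sym (negbTE kt) mul0r.
Qed.

(** The pivot columns of the solution form the matrix [G]. On S the interpolation equation makes
    [Y i] proportional to the value of the interpolant, and the weight makes the factor nonzero;
    outside S the point is the inverse image under [G]. *)
Lemma good_back Y : independent Y -> Y (pt0 n') = (1, 0) ->
    (forall i, i != pt0 n' -> (Y i).2 = 1) -> frame_good Y ->
  good (back Y) /\ exists G s, moebius_equiv Y (cfg (back Y)) G s.
Proof.
move=> iY Y0 Y1 [det0 w0]; set a := back Y.
pose G := ((num_sol Y pivot0, num_sol Y pivot1), (den_sol Y pivot0, den_sol Y pivot1)).
have G0 : hbr G.1 G.2 != 0 by rewrite /hbr.
have PE l : num_sol Y l = G.1.1 * alpha a l + G.1.2 * beta a l.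
  by case: l => [[]|j]; rewrite /= ?mulr0 ?mulr1 ?addr0 ?add0r //;
    move: det0; rewrite /frame_det => det0; field.
have QE l : den_sol Y l = G.2.1 * alpha a l + G.2.2 * beta a l.
  by case: l => [[]|j]; rewrite /= ?mulr0 ?mulr1 ?addr0 ?add0r //;
    move: det0; rewrite /frame_det => det0; field.
pose s i := if i \in codom e then (weight Y i)^-1 else weight Y i / hbr G.1 G.2.
have s0 i : s i != 0 by rewrite /s; case: ifP => _; rewrite ?mulf_neq0 ?invr_eq0.
have YE i : Y i = scale_pair (s i) (moebius G (cfg a i)).
  have := w0 i; rewrite /s /weight /cfg; case: ifP => [iS|/negbT iS] wi.
    have -> : moebius G (comb (alpha a) i, comb (beta a) i) =
        (comb (num_sol Y) i, comb (den_sol Y) i).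
      by rewrite /moebius /= (eq_comb i PE) (eq_comb i QE) !combD.
    have := @sol_interpolates Y i iS.
    have [i0|i0] := eqVneq i (pt0 n').
      rewrite i0 Y0 /= mulr0 mulr1 /scale_pair /= => <-.
      by rewrite i0 eqxx in wi; rewrite mulr0 mulVf.
    rewrite (Y1 i i0) mulr1 /scale_pair /= => ->.
    by rewrite (negbTE i0) in wi; rewrite mulrA !mulVf // mul1r -(Y1 i i0); case: (Y i).
  have xE : \sum_(j : T) B i j * a (inr j) = back_num Y i / back_den Y i.
    rewrite /a /=; under eq_bigr do rewrite mulr_sumr.
    rewrite exchange_big /= (bigD1 (Sub i iS)) //= [X in _ + X]big1 ?addr0 => [|k kt].
      under eq_bigr do rewrite mulrA; rewrite -mulr_suml.
      by rewrite (BK (Sub i iS) (Sub i iS)) eqxx mul1r.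
    under eq_bigr do rewrite mulrA; rewrite -mulr_suml.
    by rewrite (BK (Sub i iS) k) eq_sym (negbTE kt) mul0r.
  rewrite xE /scale_pair /moebius /=; move: wi G0.
  rewrite /back_den /back_num /hbr /G /=; case: (Y i) => y1 y2 /= wi G0.
  by congr pair; field; apply/andP.
have YX : moebius_equiv Y (cfg a) G s by split.
have ia : independent (cfg a).
  by apply: proj_equiv_independent (proj_equiv_sym (moebius_proj_equiv YX)) iY.
split; last by exists G, s.
apply/goodP; split=> // u v /(interpolates_moebius YX) uv.
have [s1 s1P] : exists s1, sol Y s1 != 0.
  have [P0|P0] := eqVneq (sol Y (inl pivot0)) 0; last by exists (inl pivot0).
  exists (inl pivot1); apply: contraNneq det0 => P1.
  by rewrite /frame_det /num_sol P0 P1 !mul0r subrr.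
have [c [uE vE]] := sol_span s1P uv; exists c; split=> l; apply: (mulfI G0).
  transitivity (G.2.2 * (G.1.1 * u l + G.1.2 * v l) - G.1.2 * (G.2.1 * u l + G.2.2 * v l)).
    by rewrite /hbr; ring.
  by rewrite uE vE PE QE /hbr; ring.
transitivity (G.1.1 * (G.2.1 * u l + G.2.2 * v l) - G.2.1 * (G.1.1 * u l + G.1.2 * v l)).
  by rewrite /hbr; ring.
by rewrite uE vE PE QE /hbr; ring.
Qed.

End Parametrization.

(** * The birational map *)

Section RegularParam.
Variables (K : fieldType) (n' r : nat).
Let n := n'.+3.
Variable e : 'I_(#|{: label r + label r}|.-1) -> 'I_n.
Variable ell : label r -> 'I_n -> K.
Let T : finType := {i : 'I_n | i \notin codom e}.
Variables (B : 'I_n -> T -> K) (B' : T -> T -> K).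
Variables (I : finType) (D : P1pow K I -> Prop).

Lemma regular_hbr (u v : P1pow K I -> K * K) :
    regular D (fun x => (u x).1) -> regular D (fun x => (u x).2) ->
    regular D (fun x => (v x).1) -> regular D (fun x => (v x).2) ->
  regular D (fun x => hbr (u x) (v x)).
Proof. by move=> u1 u2 v1 v2; apply: regularB; apply: regularM. Qed.

Lemma regular_comb (u : P1pow K I -> label r -> K) i :
  (forall l, regular D (fun x => u x l)) -> regular D (fun x => comb ell (u x) i).
Proof. by move=> ru; apply: regular_sum => l _; apply: regularM => //; apply: regularC. Qed.

Section FromConfig.
Variable Y : P1pow K I -> 'I_n -> K * K.
Hypothesis Y1 : forall i, regular D (fun x => (Y x i).1).
Hypothesis Y2 : forall i, regular D (fun x => (Y x i).2).

Lemma regular_sol s : regular D (fun x => sol e ell (Y x) s).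
Proof.
apply: regularM; first exact: regularC.
apply: regular_det => i j.
pose h x := match enum_val (lift (enum_rank s) j) with
  | inl l => ell l (e i) * (Y x (e i)).2
  | inr l => - (ell l (e i) * (Y x (e i)).1) end.
apply: (@regular_ext _ _ _ h); first by move=> x _; rewrite !mxE.
rewrite /h; case: (enum_val _) => l; last apply: regularN;
  by apply: regularM; (exact: regularC || exact: Y1 || exact: Y2).
Qed.

Lemma regular_frame_det : regular D (fun x => frame_det e ell (Y x)).
Proof.
rewrite /frame_det /num_sol /den_sol.
by apply: regularB; apply: regularM; apply: regular_sol.
Qed.

Lemma regular_back_num i : regular D (fun x => back_num e ell (Y x) i).
Proof.
exact: regularB (regularM (regular_sol _) (Y1 i)) (regularM (regular_sol _) (Y2 i)).
Qed.

Lemma regular_back_den i : regular D (fun x => back_den e ell (Y x) i).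
Proof.
exact: regularB (regularM (regular_sol _) (Y2 i)) (regularM (regular_sol _) (Y1 i)).
Qed.

Lemma regular_weight i : regular D (fun x => weight e ell (Y x) i).
Proof.
rewrite /weight /num_sol /den_sol; case: (i \in codom e); last exact: regular_back_den.
by case: (i == pt0 n'); apply: regular_comb => l; apply: regular_sol.
Qed.

Lemma regular_back k : (forall x, D x -> frame_good e ell (Y x)) ->
  regular D (fun x => back ell B' (Y x) k).
Proof.
move=> Dgood; have rdet : regular D (fun x => (frame_det e ell (Y x))^-1).
  by apply: regularV; [move=> x /Dgood []|apply: regular_frame_det].
rewrite /back /num_sol /den_sol; case: k => [[j|j]|t].
- by apply: regularM => //; apply: regularB; apply: regularM; apply: regular_sol.
- by apply: regularM => //; apply: regularB; apply: regularM; apply: regular_sol.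
apply: regular_sum => j _; apply: regularM; first exact: regularC.
apply: regularM; first exact: regular_back_num.
apply: regularV; last exact: regular_back_den.
move=> x /Dgood [_ /(_ (val j))]; rewrite /weight ifN //; exact: valP j.
Qed.

End FromConfig.

Section FromParam.
Variable a : P1pow K I -> param_idx e -> K.
Hypothesis ra : forall k, regular D (fun x => a x k).

Lemma regular_cfg i :
  regular D (fun x => (cfg ell B (a x) i).1) /\ regular D (fun x => (cfg ell B (a x) i).2).
Proof.
rewrite /cfg; case: (i \in codom e) => /=; split.
- by apply: regular_comb => -[b|j] /=; [apply: regularC|apply: ra].
- by apply: regular_comb => -[b|j] /=; [apply: regularC|apply: ra].
- by apply: regular_sum => j _; apply: regularM; [apply: regularC|apply: ra].
exact: regularC.
Qed.

End FromParam.
End RegularParam.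

(** * Mutually inverse equivariant maps *)

Section Birational.
Variables (F : fieldType) (K : closedFieldType) (iota : {rmorphism F -> K}) (n' r : nat).
Let n := n'.+3.
Variable e : 'I_(#|{: label r + label r}|.-1) -> 'I_n.
Variable ell : label r -> 'I_n -> K.
Let T : finType := {i : 'I_n | i \notin codom e}.
Variables (B : 'I_n -> T -> K) (B' : T -> T -> K).
Hypothesis BK : forall i l : T, \sum_j B (val i) j * B' j l = (i == l)%:R.
Hypothesis B'K : forall i l : T, \sum_j B' i j * B (val j) l = (i == l)%:R.
Variable rho : galrep iota n.
Hypothesis e_stable : forall s i, (rho s i \in codom e) = (i \in codom e).
Hypothesis ell_equiv : forall (s : absgal iota) l i, i \in codom e ->
  s (ell l i) = ell l (rho s i).
Hypothesis B_equiv : forall (s : absgal iota) i j, i \notin codom e ->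
  s (B i j) = B (rho s i) j.

Local Notation idx := (param_idx e).
Local Notation d := #|{: idx}|.
Local Notation config := (cfg ell B).
Local Notation admissible := (good ell B).
Local Notation recover := (back ell B').

Definition coords (x : P1pow K 'I_d) (k : idx) : K := odflt 0 (x (enum_rank k)).
Definition point (a : idx -> K) : P1pow K 'I_d := [ffun k => Some (a (enum_val k))].

Lemma coordsK x : affine_pt x -> point (coords x) = x.
Proof.
move=> xA; apply/ffunP => k; rewrite ffunE /coords enum_valK.
by move: (xA k); case: (x k).
Qed.

Lemma pointK a : coords (point a) =1 a.
Proof. by move=> k; rewrite /coords ffunE enum_rankK. Qed.

Lemma point_affine a : affine_pt (point a).
Proof. by move=> k; rewrite ffunE. Qed.

Lemma eq_cfg a a' : a =1 a' -> config a =1 config a'.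
Proof.
move=> aa' i; rewrite /cfg; case: ifP => _; last first.
  by under eq_bigr do rewrite aa'.
by congr pair; apply: eq_bigr => -[b|j] _ //=; rewrite aa'.
Qed.

Lemma eq_good a a' : a =1 a' -> admissible a -> admissible a'.
Proof.
move=> aa' /goodP [ind ker]; have cfgE := eq_cfg aa'.
apply/goodP; split=> [i j ij|u v uv]; first by rewrite -!cfgE; apply: ind.
have [|c [uE vE]] := ker u v; first by move=> i iS; rewrite !cfgE; apply: uv.
by exists c; split=> l; rewrite ?uE ?vE; case: l => [b|j] //=; rewrite aa'.
Qed.

Lemma eq_cross_ratios (X X' : 'I_n -> K * K) : X =1 X' -> cross_ratios X = cross_ratios X'.
Proof. by move=> XX'; apply/ffunP => q; rewrite !ffunE /cr_num /cr_den !XX'. Qed.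

(** Phrased by conditions that are visibly open but depend on the frame. Its stability under the
    twisted action comes from its being the image of [V_set]. *)
Definition U_set (c : P1pow K (quad n)) : Prop :=
  [/\ Mbar c, forall q, generic_value (c q) & frame_good e ell (frame c)].

Definition V_set (x : P1pow K 'I_d) : Prop := affine_pt x /\ admissible (coords x).

Definition to_affine (c : P1pow K (quad n)) : P1pow K 'I_d := point (recover (frame c)).

Definition to_Mbar (x : P1pow K 'I_d) : P1pow K (quad n) := cross_ratios (config (coords x)).

Lemma frame0 (c : P1pow K (quad n)) : frame c (pt0 n') = (1, 0).
Proof. by rewrite /frame eqxx. Qed.

Lemma frame1 (c : P1pow K (quad n)) i : i != pt0 n' -> (frame c i).2 = 1.
Proof. by move=> i0; rewrite /frame (negbTE i0). Qed.

Lemma to_Mbar_U x : V_set x -> U_set (to_Mbar x) /\ to_affine (to_Mbar x) = x.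
Proof.
move=> [xA xgood]; have [ind _] := xgood.
have [G [s YX]] := frame_moebius ind.
have [fg bE] := frame_good_of_good B'K xgood YX (frame0 _) (@frame1 _).
split; first split=> //.
- by apply: Mbar_cross_ratios.
- move=> q; rewrite /to_Mbar cross_ratiosE // /generic_value /=.
  have n0 := cr_num_neq0 q ind; have d0 := cr_den_neq0 q ind.
  have nd := cr_num_den_neq q ind.
  apply/andP; split; apply/eqP => -[] /eqP; first by rewrite mulf_eq0 invr_eq0 (negbTE n0) (negbTE d0).
  by rewrite -(inj_eq (mulIf d0)) mul1r divfK // (negbTE nd).
rewrite -[RHS]coordsK //; apply/ffunP => k; rewrite !ffunE; congr Some; exact: bE.
Qed.

Lemma to_affine_V c : U_set c -> V_set (to_affine c) /\ to_Mbar (to_affine c) = c.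
Proof.
move=> [cM gc fg]; have [X iX cE] := @Mbar_generic K n _ isT cM gc.
have [G [s YX]] := frame_moebius iX; rewrite -cE in YX.
have iY := proj_equiv_independent (moebius_proj_equiv YX) iX.
have [ga [G' [s' YX']]] := good_back BK iY (frame0 c) (@frame1 c) fg.
have bE : recover (frame c) =1 coords (to_affine c) by move=> k; rewrite pointK.
split; first by split; [apply: point_affine|apply: eq_good ga].
rewrite /to_Mbar -(eq_cross_ratios (eq_cfg bE)) [RHS]cE; apply/ffunP => q.
rewrite -(proj_equiv_cross_ratio q (moebius_proj_equiv YX')).
by rewrite (proj_equiv_cross_ratio q (moebius_proj_equiv YX)).
Qed.

Lemma coords_conj (s : absgal iota) x : affine_pt x -> coords (conj_pt s x) =1 (fun k => s (coords x k)).
Proof. by move=> xA k; rewrite /coords ffunE /conj_P1; move: (xA (enum_rank k)); case: (x _). Qed.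

(** Conjugation permutes the values of [ell] and [B] in the same way as the labels, so conjugating
    the coordinates relabels and conjugates the configuration. *)
Lemma cfg_equiv (s : absgal iota) (a : idx -> K) i :
  config (fun k => s (a k)) (rho s i) = (s (config a i).1, s (config a i).2).
Proof.
rewrite /cfg e_stable; case: ifP => [iS|/negbT iS] /=.
  have combE (u u' : label r -> K) : (forall l, u' l = s (u l)) ->
      comb ell u' (rho s i) = s (comb ell u i).
    move=> uE; rewrite /comb rmorph_sum; apply: eq_bigr => l _.
    by rewrite rmorphM uE ell_equiv.
  by congr pair; apply: combE => -[b|j] //=; rewrite rmorph_nat.
rewrite rmorph1 rmorph_sum; congr pair; apply: eq_bigr => j _.
by rewrite rmorphM B_equiv.
Qed.

Lemma hbr_rmorph (s : absgal iota) (u v : K * K) :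
  hbr (s u.1, s u.2) (s v.1, s v.2) = s (hbr u v).
Proof. by rewrite /hbr rmorphB !rmorphM. Qed.

Lemma V_set_conj (s : absgal iota) x : V_set x -> V_set (conj_pt s x).
Proof.
move=> [xA xg]; split; first exact: affine_act_pt.
apply: (eq_good (a := fun k => s (coords x k))) => [k|]; first by rewrite coords_conj.
have [ind ker] := (goodP _ _ _).1 xg.
have rhoK i : rho s (((rho s)^-1)%g i) = i by rewrite permKV.
apply/goodP; split=> [i j ij|u v uv].
  rewrite -(rhoK i) -(rhoK j) !cfg_equiv hbr_rmorph fmorph_eq0; apply: ind.
  by rewrite (inj_eq perm_inj).
(* The inverse of [s] turns interpolants of the conjugate configuration into interpolants of the
   original one. *)
have [t tK Kt] := absgal_bij s.
have [|c [uE vE]] := ker (fun l => t (u l)) (fun l => t (v l)); last first.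
  exists (s c); split=> l.
    by rewrite -[LHS]Kt uE rmorphM; case: l => [b|j] //=; rewrite rmorph_nat.
  by rewrite -[LHS]Kt vE rmorphM; case: l => [b|j] //=; rewrite rmorph_nat.
move=> i iS; have := uv (rho s i); rewrite e_stable => /(_ iS).
have combE (w : label r -> K) : comb ell w (rho s i) = s (comb ell (fun l => t (w l)) i).
  rewrite /comb rmorph_sum; apply: eq_bigr => l _; by rewrite rmorphM Kt ell_equiv.
by rewrite !combE cfg_equiv /= -!rmorphM => /(bij_inj (absgal_bij s)).
Qed.

Lemma to_Mbar_conj (s : absgal iota) x : V_set x -> to_Mbar (conj_pt s x) = twisted_act rho s (to_Mbar x).
Proof.
move=> [xA [ind _]]; rewrite /to_Mbar (eq_cross_ratios (eq_cfg (coords_conj s xA))).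
apply/ffunP => q; rewrite !ffunE /conj_P1.
set h := config (fun k => s (coords x k)).
have hE k : h (q k) = (s (config (coords x) (relabel_quad ((rho s)^-1)%g q k)).1,
                       s (config (coords x) (relabel_quad ((rho s)^-1)%g q k)).2).
  rewrite -[in LHS](permKV (rho s) (q k)) /h cfg_equiv.
  by rewrite -[relabel_quad _ _ k]/(quad_fun (relabel_quad _ _) k) ffunE.
rewrite /cr_num /cr_den !hE !hbr_rmorph -!rmorphM /of_hcoord fmorph_eq0.
by case: ifP => //= _; rewrite fmorph_div.
Qed.

Lemma V_open : exists D, principal D /\ forall x, V_set x <-> affine_pt x /\ D x.
Proof.
pose fin (x : P1pow K 'I_d) := forall i, x i != None.
have affE x : affine_pt x <-> fin x.
  by split=> h i; [apply/eqP; apply: h|apply/eqP; apply: h].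
have rc k : regular fin (fun x => coords x k).
  by apply: regular_coord => y; apply.
have [rcfg1 rcfg2] : (forall i, regular fin (fun x => (config (coords x) i).1)) /\
    (forall i, regular fin (fun x => (config (coords x) i).2)).
  by split=> i; have [] := regular_cfg ell B rc i.
pose h x := (\prod_(ij : 'I_n * 'I_n | ij.1 != ij.2)
    hbr (config (coords x) ij.1) (config (coords x) ij.2)) *
  sol e ell (config (coords x)) (inl pivot0).
have rh : regular fin h.
  apply: regularM; last exact: regular_sol.
  by apply: regular_prod => ij _; apply: regular_hbr.
exists (fun x => fin x /\ h x != 0); split.
  exact: principal_neq0 (principal_finite _ _) rh.
move=> x; rewrite /h mulf_eq0 negb_or; split.
  move=> [xA [ind s0]]; split=> //; split; first exact/affE.
  by rewrite s0 andbT; apply/prodf_neq0 => -[i j]; apply: ind.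
move=> [xA [_ /andP [/prodf_neq0 ind s0]]]; split=> //; split=> // i j ij.
exact: ind (i, j) ij.
Qed.

Lemma U_open : exists D, principal D /\ forall c, U_set c <-> Mbar c /\ D c.
Proof.
pose fin (c : P1pow K (quad n)) := forall q, c q != None.
have rc q : regular fin (fun c => odflt 0 (c q)).
  by apply: regular_coord => y; apply.
pose h1 (c : P1pow K (quad n)) := \prod_q (odflt 0 (c q) * (odflt 0 (c q) - 1)).
have rf i : regular fin (fun c => (frame c i).1) /\ regular fin (fun c => (frame c i).2).
  rewrite /frame; case: (i == pt0 n') => /=; split; try exact: regularC.
  by rewrite /frame_coord; case: (base_quad i) => [q|]; [apply: rc|apply: regularC].
pose h2 c := frame_det e ell (frame c) * \prod_i weight e ell (frame c) i.
have rh : regular fin (fun c => h1 c * h2 c).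
  apply: regularM.
    apply: regular_prod => q _; apply: regularM => //; apply: regularB => //.
    exact: regularC.
  apply: regularM.
    by apply: regular_frame_det => i; case: (rf i).
  by apply: regular_prod => i _; apply: regular_weight => j; case: (rf j).
exists (fun c => fin c /\ h1 c * h2 c != 0); split.
  exact: principal_neq0 (principal_finite _ _) rh.
move=> c; rewrite /h2 !mulf_eq0 !negb_or; split.
  move=> [cM gc [det0 w0]]; split=> //; split; first by move=> q; case/and3P: (gc q).
  rewrite det0 /=; apply/andP; split; apply/prodf_neq0 => // q _.
  by case/and3P: (gc q); case: (c q) => //= y _ y0 y1; rewrite mulf_neq0 // subr_eq0.
move=> [cM [cfin /and3P [/prodf_neq0 c0 det0 /prodf_neq0 w0]]]; split=> //.
  move=> q; have := c0 q isT; have := cfin q; rewrite /generic_value; case: (c q) => //= y _.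
  by rewrite mulf_eq0 negb_or subr_eq0.
by split=> // i; apply: w0.
Qed.

Theorem rational_of_frame_data : (exists a, admissible a) -> rational (twisted_Mbar rho).
Proof.
move=> [a0 ga0]; exists d.
have [DU [pU UE]] := U_open; have [DV [pV VE]] := V_open.
pose x0 := point a0.
have Vx0 : V_set x0.
  by split; [apply: point_affine|apply: (eq_good _ ga0) => k; rewrite pointK].
have eq_U : zopen (@Mbar K n) U_set /\ zdense (@Mbar K n) U_set.
  split.
    have [Usub Uop] := zopen_principal (@Mbar K n) pU; split.
      by move=> c /UE; apply: Usub.
    move=> c /UE /Uop [e' [R [hR Rc RU]]]; exists e', R; split=> // c' cM' Rc'.
    by apply/UE; apply: RU.
  move=> W Wop Wne; have [_ indx0] := Vx0; have [indx _] := indx0.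
  have [Ux0 _] := to_Mbar_U Vx0.
  have [X [iX DX WX]] := Mbar_dense pU indx ((UE _).1 Ux0).2 Wop Wne.
  exists (cross_ratios X); split; first exact: WX.
  by apply/UE; split=> //; apply: Mbar_cross_ratios.
have eq_V : zopen (@affine_pt K d) V_set /\ zdense (@affine_pt K d) V_set.
  split.
    have [Vsub Vop] := zopen_principal (@affine_pt K d) pV; split.
      by move=> x /VE; apply: Vsub.
    move=> x /VE /Vop [e' [R [hR Rx RV]]]; exists e', R; split=> // y yA Ry.
    by apply/VE; apply: RV.
  move=> W Wop Wne.
  have [|x [Wx Dx]] := affine_dense pV _ Wop Wne; first by exists x0; apply/VE.
  by exists x; split=> //; apply/VE.
(* The twisted action on [U_set] is transported from affine space; its stability and the
   equivariance of [to_affine] both follow from this. *)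
have U_act s c : U_set c -> twisted_act rho s c = to_Mbar (conj_pt s (to_affine c)).
  by move=> Uc; have [Vc cE] := to_affine_V Uc; rewrite to_Mbar_conj // cE.
exists U_set, V_set, to_affine, to_Mbar; split.
- case: eq_U => Uop Udense; split=> // s c Uc; rewrite /= U_act //.
  by have [Vc _] := to_affine_V Uc; have [] := to_Mbar_U (V_set_conj s Vc).
- by case: eq_V => Vop Vdense; split=> // s x; apply: V_set_conj.
- split=> [|c /to_affine_V []//|c /to_affine_V []//].
  apply: (@morphism_on_regular _ _ _ _ _ (fun k c => recover (frame c) (enum_val k))); last first.
    by move=> c k _; rewrite ffunE.
  move=> k; apply: regular_back => [i|i|c []//].
    rewrite /frame; case: (i == pt0 n') => /=; first exact: regularC.
    rewrite /frame_coord; case: (base_quad i) => [q|]; last exact: regularC.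
    by apply: regular_coord => y [_ /(_ q) /and3P []].
  by rewrite /frame; case: (i == pt0 n') => /=; apply: regularC.
- split=> [|x /to_Mbar_U []//|x /to_Mbar_U []//].
  apply: (@morphism_on_regular _ _ _ _ _ (fun q x =>
      cr_num (config (coords x)) q / cr_den (config (coords x)) q)); last first.
    by move=> x q [xA [ind _]]; rewrite /to_Mbar cross_ratiosE.
  move=> q.
  have rc k : regular V_set (fun x => coords x k).
    by apply: regular_coord => y [/(_ (enum_rank k)) /eqP].
  have rcfg1 i := (regular_cfg ell B rc i).1; have rcfg2 i := (regular_cfg ell B rc i).2.
  apply: regularM; first by apply: regularM; apply: regular_hbr.
  apply: regularV; last by apply: regularM; apply: regular_hbr.
  by move=> x [_ [ind _]]; apply: cr_den_neq0.
move=> s c Uc; rewrite /= U_act //; have [Vc cE] := to_affine_V Uc.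
by have [_ ->] := to_Mbar_U (V_set_conj s Vc).
Qed.

End Birational.

(** * Galois theory of a finite field *)

Section FiniteGalois.
Variables (F : finFieldType) (K : closedFieldType) (iota : {rmorphism F -> K}).
Hypothesis algK : integralRange iota.

Local Notation q := #|F|.

Lemma card_pnat N : [pchar K].-nat (q ^ N)%N.
Proof.
have [p p_pr pF] := finPcharP F.
have pK : p \in [pchar K] by rewrite (fmorph_pchar iota).
apply: (@sub_in_pnat p); first by move=> p' _ /eqP ->.
by rewrite (card_pprimeChar pF) -expnM pnatX pnat_id.
Qed.

Lemma frobD N (x y : K) : (x + y) ^+ (q ^ N) = x ^+ (q ^ N) + y ^+ (q ^ N).
Proof. exact: exprDn_pchar (card_pnat N). Qed.

Definition frob_fun N (x : K) : K := x ^+ (q ^ N).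

Fact frob_zmod N : zmod_morphism (frob_fun N).
Proof.
move=> x y; apply: (@addIr _ (frob_fun N y)); rewrite subrK.
by rewrite /frob_fun -frobD subrK.
Qed.

Fact frob_monoid N : monoid_morphism (frob_fun N).
Proof. by split=> [|x y]; rewrite /frob_fun ?expr1n ?exprMn. Qed.

HB.instance Definition _ N := GRing.isZmodMorphism.Build K K (frob_fun N) (frob_zmod N).
HB.instance Definition _ N := GRing.isMonoidMorphism.Build K K (frob_fun N) (frob_monoid N).

Lemma q_gt1 : (1 < q)%N.
Proof. exact: finNzRing_gt1. Qed.

Lemma frob_bij N : bijective (frob_fun N).
Proof.
have qN : (0 < q ^ N)%N by rewrite expn_gt0 (ltnW q_gt1).
have ex y : exists x, frob_fun N x == y.
  have [x xE] := solve_monicpoly (fun i => if i == 0%N then y else 0) qN.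
  exists x; rewrite /frob_fun xE; apply/eqP.
  rewrite -(prednK qN) big_ord_recl /= expr0 mulr1 big1 ?addr0 // => i _.
  by rewrite mul0r.
exists (fun y => xchoose (ex y)) => x; last exact: eqP (xchooseP (ex x)).
exact: fmorph_inj (eqP (xchooseP (ex (frob_fun N x)))).
Qed.

Lemma frob_fix N a : frob_fun N (iota a) = iota a.
Proof.
rewrite /frob_fun -rmorphXn; congr (iota _); elim: N => [|N IH]; first by rewrite expr1.
by rewrite expnSr exprM IH expf_card.
Qed.

Definition frob N : absgal iota := AbsGal (frob_bij N) (@frob_fix N).

Lemma frobE N x : frob N x = x ^+ (q ^ N). Proof. by []. Qed.

(** The roots of X^q - X in [K] are exactly the images of the elements of [F]. *)
Lemma fixed_by_frob (x : K) : x ^+ q = x -> exists a, x = iota a.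
Proof.
move=> xq; have : root (map_poly iota ('X^q - 'X)) x.
  by rewrite rmorphB /= map_polyXn map_polyX rootE !hornerE xq subrr.
have -> : map_poly iota ('X^q - 'X) = \prod_(z <- [seq iota b | b : F]) ('X - z%:P).
  rewrite finField_genPoly rmorph_prod big_image /=.
  by apply: eq_bigr => b _; rewrite rmorphB /= map_polyX map_polyC.
by rewrite root_prod_XsubC => /mapP [a _ ->]; exists a.
Qed.

Lemma frob_comp N M x : frob (N + M) x = frob N (frob M x).
Proof. by rewrite !frobE -exprM -expnD addnC. Qed.

(** The Frobenius iterates of [x] are roots of one polynomial over [F], so two of them coincide, and
    Frobenius is injective. *)
Lemma frob_periodic (x : K) : exists2 M, (0 < M)%N & frob M x = x.
Proof.
have [p p_monic px] := algK x.
have root_frob N : root (map_poly iota p) (frob N x).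
  have -> : map_poly iota p = map_poly (frob N) (map_poly iota p).
    by rewrite -map_poly_comp; apply: eq_map_poly => a; rewrite /= frob_fix.
  by rewrite fmorph_root.
have [r pE] := closed_field_poly_normal (map_poly iota p).
have lc : lead_coef (map_poly iota p) != 0.
  by rewrite lead_coef_eq0 map_poly_eq0 monic_neq0.
have in_r N : frob N x \in r.
  by move: (root_frob N); rewrite pE rootZ // root_prod_XsubC.
pose l := mkseq (fun N => frob N x) (size r).+1.
have /uniqPn : ~~ uniq l.
  apply/negP => /uniq_leq_size l_le; have : (size l <= size r)%N.
    by apply: l_le => y /mapP [N _ ->].
  by rewrite size_mkseq ltnn.
case/(_ 0) => i [j [ij jl]]; rewrite size_mkseq in jl.
rewrite !nth_mkseq // ?(ltn_trans ij) // => E.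
exists (j - i)%N; first by rewrite subn_gt0.
apply: (bij_inj (frob_bij i)); rewrite -[LHS]/(frob i (frob (j - i) x)) -frob_comp.
by rewrite (subnKC (ltnW ij)).
Qed.

Lemma frob_periodicM (x : K) M k : frob M x = x -> frob (k * M) x = x.
Proof.
move=> xM; elim: k => [|k IH]; first by rewrite frobE expn0 expr1.
by rewrite mulSn frob_comp IH.
Qed.

Lemma frob_periodic_seq (A : seq K) : exists2 M, (0 < M)%N & {in A, forall x, frob M x = x}.
Proof.
elim: A => [|x A [M M0 AM]]; first by exists 1%N.
have [M' M'0 xM'] := frob_periodic x; exists (M * M')%N; first by rewrite muln_gt0 M0.
move=> y; rewrite inE => /orP [/eqP ->|yA]; first exact: frob_periodicM.
by rewrite mulnC frob_periodicM ?AM.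
Qed.

(** [k] equals -1 in [K], so X^k - 1 is separable and has [k] distinct roots. *)
Lemma primitive_root_exists M : (0 < M)%N -> exists z : K, (q ^ M).-1.-primitive_root z.
Proof.
move=> M0; set k := (q ^ M).-1.
have qM1 : (1 < q ^ M)%N by rewrite -(exp1n M) ltn_exp2r ?q_gt1.
have k0 : (0 < k)%N by rewrite /k -ltnS prednK // ltnW.
have kK : k%:R != 0 :> K.
  have qM0 : (q ^ M)%:R = 0 :> K.
    have [p p_pr pF] := finPcharP F.
    have pK : p \in [pchar K] by rewrite (fmorph_pchar iota).
    have [l ql] : exists l, q = (p ^ l)%N by exists (logn p q); apply: card_pprimeChar.
    apply/eqP; rewrite -(dvdn_pcharf pK).
    move: qM1; rewrite ql -expnM; case: (l * M)%N => [|j] // _.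
    by rewrite expnS dvdn_mulr.
  have : (k.+1)%:R = 0 :> K by rewrite /k prednK // ltnW.
  by rewrite -natr1 => /eqP; rewrite addr_eq0 => /eqP ->; rewrite oppr_eq0 oner_neq0.
have [rs rsE] := closed_field_poly_normal ('X^k - 1 : {poly K}).
have monX : lead_coef ('X^k - 1 : {poly K}) = 1 by apply/eqP; exact: monicXnsubC.
rewrite monX scale1r in rsE.
have rs_uniq : uniq rs by rewrite -separable_prod_XsubC -rsE separable_Xn_sub_1.
have rs_root : all k.-unity_root rs.
  apply/allP => z; rewrite -root_prod_XsubC -rsE.
  by rewrite unity_rootE rootE !hornerE subr_eq0.
have size_rs : (k <= size rs)%N.
  by rewrite -ltnS -(size_prod_XsubC rs id) -rsE size_XnsubC.
have /hasP [z _ zP] := has_prim_root k0 rs_root rs_uniq size_rs.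
by exists z.
Qed.

Lemma primitive_root_frob M (z : K) : (0 < M)%N -> (q ^ M).-1.-primitive_root z -> frob M z = z.
Proof.
move=> M0 zP; have qM : (0 < q ^ M)%N by rewrite expn_gt0 (ltnW q_gt1).
by rewrite frobE -(prednK qM) exprS (prim_expr_order zP) mulr1.
Qed.

(** Some power of Frobenius fixes [A], whose nonzero elements are then powers of a primitive root
    [z]. The product of the X - frob^j(z) has coefficients in [F], so [s] sends [z] to one of its
    Frobenius conjugates, and this determines [s] on [A]. *)
Lemma absgal_frob (s : absgal iota) (A : seq K) : exists N, {in A, forall x, s x = frob N x}.
Proof.
have [[//|M] _ AM] := frob_periodic_seq A; have [z zP] := @primitive_root_exists M.+1 isT.
have zM := primitive_root_frob (ltn0Sn M) zP.
pose P : {poly K} := \prod_(j < M.+1) ('X - (frob j z)%:P).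
have PF : map_poly (frob 1) P = P.
  rewrite /P rmorph_prod /= big_ord_recr [RHS]big_ord_recl mulrC.
  have fE j : map_poly (frob 1) ('X - (frob j z)%:P) = 'X - (frob j.+1 z)%:P.
    by rewrite rmorphB /= map_polyX map_polyC -[j.+1]add1n frob_comp.
  congr (_ * _); first by apply: eq_bigr => j _; apply: fE.
  by rewrite [LHS]fE zM -/(frob 0 z) frobE expn0 expr1.
have Ps : map_poly s P = P.
  apply/polyP => i; rewrite coef_map /=.
  have [a ->] : exists a, P`_i = iota a; last exact: absgal_fix.
  apply: fixed_by_frob.
  by have /(congr1 (coefp i)) := PF; rewrite /= coef_map /= /frob_fun expn1.
have /existsP [N /eqP sz] : [exists N : 'I_M.+1, s z == frob N z].
  have : root P (s z).
    rewrite -Ps fmorph_root /P /root horner_prod (bigD1 ord0) //= frobE expn0 expr1.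
    by rewrite !hornerE subrr mul0r.
  rewrite /root horner_prod => /prodf_eq0 [N _].
  by rewrite !hornerE subr_eq0 => h; apply/existsP; exists N.
exists N => x xA; have [->|x0] := eqVneq x 0; first by rewrite !rmorph0.
have [i ->] : {i : 'I_(q ^ M.+1).-1 | x = z ^+ i}.
  apply: (prim_rootP zP); apply: (mulfI x0).
  by rewrite mulr1 -exprS prednK ?expn_gt0 ?(ltnW q_gt1) // -frobE AM.
by rewrite !rmorphXn sz.
Qed.

Lemma frob_orbit_exists d : (0 < d)%N -> exists z : K,
  [/\ z != 0, frob d z = z & forall i j, (i < d)%N -> (j < d)%N -> frob i z = frob j z -> i = j].
Proof.
move=> d0; have [z zP] := primitive_root_exists d0; exists z.
have qd : (0 < q ^ d)%N by rewrite expn_gt0 (ltnW q_gt1).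
split; [|exact: primitive_root_frob|].
  apply/eqP => z0; have /eqP := prim_expr_order zP.
  rewrite z0 expr0n; have := prim_order_gt0 zP.
  by case: (_.-1) => [//|k] _; rewrite /= eq_sym oner_eq0.
move=> i j id jd /eqP; rewrite !frobE (eq_prim_root_expr zP).
(* For [d = 1] and q = 2 the bound below fails, but then both exponents are 0. *)
have [d1|d1] := leqP d 1; first by move: id jd; case: d d0 d1 {zP qd} => [|[]] // _ _; case: i j => [|i] [|j].
have small k : (k < d)%N -> (q ^ k < (q ^ d).-1)%N.
  move=> kd; rewrite -ltnS prednK //.
  have : (q ^ k.+1 <= q ^ d)%N by rewrite leq_exp2l ?q_gt1.
  have := q_gt1; have := leq_exp2l k 0 q_gt1; rewrite expnS.
  case: k kd => [|k] kd.
    have : (q ^ 2 <= q ^ d)%N by rewrite leq_exp2l ?q_gt1.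
    by rewrite expn0; nia.
  have : (1 < q ^ k.+1)%N by rewrite -[1%N](exp1n k.+1) ltn_exp2r ?q_gt1.
  nia.
by rewrite !modn_small ?small // eqn_exp2l ?q_gt1 // => /eqP.
Qed.

(** An element with as many conjugates as the cycle has points is placed at the root of the cycle
    and carried along it by Frobenius. Injectivity is claimed within a cycle only. *)
Lemma cycle_generator (n : nat) (g : 'S_n) : exists h : 'I_n -> K,
  [/\ forall i, h (g i) = frob 1 (h i), forall i, h i != 0
    & forall i j, fconnect g i j -> h i = h j -> i = j].
Proof.
have g_inj : injective g by exact: perm_inj.
have g_sym : connect_sym (frel g) by exact: fconnect_sym.
have /fin_all_exists [z zP] (i : 'I_n) := frob_orbit_exists (fingraph.order_gt0 g i).
pose h i := frob (findex g (froot g i) i) (z (froot g i)).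
have rootc i : fconnect g (froot g i) i by rewrite g_sym connect_root.
exists h; split.
- move=> i; rewrite /h; have [_ zE zI] := zP (froot g i).
  have -> : froot g (g i) = froot g i by apply/eqP; rewrite root_connect // g_sym fconnect1.
  set x := froot g i; set k := findex g x i.
  have iE : iter k g x = i by apply: iter_findex; apply: rootc.
  have kd : (k < fingraph.order g x)%N by apply: findex_max; apply: rootc.
  have -> : frob 1 (frob k (z x)) = frob k.+1 (z x) by rewrite -frob_comp add1n.
  rewrite -[in LHS]iE -iterS; have [kd'|kd'] := ltnP k.+1 (fingraph.order g x).
    by rewrite findex_iter.
  (* The last point of the cycle returns to the root, where the period of [z x] closes the
     circle. *)
  have -> : k.+1 = fingraph.order g x by apply/eqP; rewrite eqn_leq kd.
  by rewrite iter_order // findex0 zE frobE expn0 expr1.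
- move=> i; have [z0 _ _] := zP (froot g i); by rewrite fmorph_eq0.
move=> i j ij; have rE : froot g i = froot g j by apply/eqP; rewrite root_connect.
rewrite /h rE; have [_ _ zI] := zP (froot g j) => hij.
have ri : fconnect g (froot g j) i by rewrite -rE.
apply: etrans (esym (iter_findex ri)) (etrans _ (iter_findex (rootc j))).
by congr (iter _ _ _); apply: zI hij; apply: findex_max.
Qed.

Variables (n : nat) (rho : galrep iota n).

Lemma galrep_frob N i : rho (frob N) i = iter N (rho (frob 1)) i.
Proof.
elim: N i => [|N IH] i.
  by rewrite (galrep1 rho) ?perm1 // => a; rewrite frobE expn0 expr1.
rewrite iterS -IH; apply: (galrepM rho (s := frob 1) (t := frob N)) => a.
by rewrite -frob_comp add1n.
Qed.

(** By continuity [rho s] depends only on the values of [s] on a finite set; on that set together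
    with [A], [s] is a power of Frobenius. *)
Lemma galrep_iter (s : absgal iota) (A : seq K) :
  exists N, {in A, forall x, s x = frob N x} /\ forall i, rho s i = iter N (rho (frob 1)) i.
Proof.
have [A' A's] := galrep_cont rho s; have [N sN] := absgal_frob s (A ++ A').
exists N; split=> [x xA|i]; first by rewrite sN // mem_cat xA.
by rewrite -galrep_frob (A's (frob N)) // => x xA; rewrite sN // mem_cat xA orbT.
Qed.

Lemma galrep_connect (s : absgal iota) i : fconnect (rho (frob 1)) i (rho s i).
Proof. by have [N [_ ->]] := galrep_iter s [::]; apply: fconnect_iter. Qed.

Lemma equivariant_iter (h : 'I_n -> K) (s : absgal iota) :
  (forall i, h (rho (frob 1) i) = frob 1 (h i)) -> forall i, s (h i) = h (rho s i).
Proof.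
move=> hE i; have [N [sN rhoN]] := galrep_iter s [seq h i | i : 'I_n].
rewrite rhoN sN ?image_f //; elim: N {sN rhoN} i => [|N IH] i.
  by rewrite frobE expn0 expr1.
by rewrite iterS hE -IH -frob_comp add1n.
Qed.

End FiniteGalois.

(** * Equivariant data *)

Lemma fun_inverse (K : fieldType) (T : finType) (A : T -> T -> K) :
    (forall c : T -> K, (forall i, \sum_j A i j * c j = 0) -> forall j, c j = 0) ->
  exists A' : T -> T -> K, (forall i l, \sum_j A i j * A' j l = (i == l)%:R) /\
    (forall i l, \sum_j A' i j * A j l = (i == l)%:R).
Proof.
move=> inj; pose M : 'M[K]_#|T| := \matrix_(i, j) A (enum_val i) (enum_val j).
have sumE (f : T -> K) : \sum_j f j = \sum_(k < #|T|) f (enum_val k).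
  rewrite (reindex (fun k : 'I_#|T| => enum_val k)) //=.
  by exists enum_rank => k _; [apply: enum_valK|apply: enum_rankK].
have uM : M \in unitmx.
  rewrite unitmxE unitfE -det_tr; apply/det0P => -[v v0 vM].
  case/eqP: v0; apply/rowP => k; rewrite mxE -[k]enum_valK.
  apply: (inj (fun j => v 0 (enum_rank j))) => i; rewrite sumE.
  have /matrixP /(_ 0 (enum_rank i)) := vM; rewrite !mxE => E; rewrite -[RHS]E.
  by apply: eq_bigr => j _; rewrite !mxE enum_valK enum_rankK mulrC.
exists (fun i j => invmx M (enum_rank i) (enum_rank j)); split=> i l; rewrite sumE.
  have /matrixP /(_ (enum_rank i) (enum_rank l)) := mulmxV uM.
  rewrite !mxE (inj_eq enum_rank_inj) => <-.
  by apply: eq_bigr => j _; rewrite !mxE enum_valK enum_rankK.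
have /matrixP /(_ (enum_rank i) (enum_rank l)) := mulVmx uM.
rewrite !mxE (inj_eq enum_rank_inj) => <-.
by apply: eq_bigr => j _; rewrite !mxE enum_valK enum_rankK.
Qed.

Lemma enum_label_codom (n r : nat) (S : {set 'I_n}) : #|S| = r.*2.+3 ->
  exists e : 'I_(#|{: label r + label r}|.-1) -> 'I_n, forall i, (i \in codom e) = (i \in S).
Proof.
move=> cS.
have E : (#|{: label r + label r}|.-1)%N = #|S|.
  by rewrite cS !card_sum card_bool card_ord; lia.
exists (fun k => enum_val (cast_ord E k)) => i; apply/codomP/idP => [[k ->]|iS].
  exact: enum_valP.
exists (cast_ord (esym E) (enum_rank_in iS i)).
by rewrite cast_ordKV enum_rankK_in.
Qed.

Section CycleMatrix.
Variables (K : closedFieldType) (n : nat) (g : 'S_n) (h : 'I_n -> K).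
Hypothesis h_inj : forall i j, fconnect g i j -> h i = h j -> i = j.

(** Block diagonal, with a Vandermonde block for each cycle. The exponent depends on the row only
    through its cycle, so an equivariant [h] makes Galois permute the rows: this substitution
    untwists the permutation action on affine coordinates. *)
Definition cycle_vandermonde (i j : 'I_n) : K :=
  if fconnect g i j then h i ^+ findex g (froot g i) j else 0.

Lemma cycle_vandermonde_inj (P : pred 'I_n) (c : {i : 'I_n | P i} -> K) :
    (forall i j, fconnect g i j -> P i = P j) ->
    (forall i : {i : 'I_n | P i}, \sum_j cycle_vandermonde (val i) (val j) * c j = 0) ->
  forall j, c j = 0.
Proof.
move=> Pg cE j0.
have g_inj : injective g by exact: perm_inj.
have g_sym : connect_sym (frel g) by exact: fconnect_sym.
set x := froot g (val j0).
have x0 : fconnect g x (val j0) by rewrite g_sym connect_root.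
(* A kernel vector restricted to a cycle gives a polynomial of degree less than the length of the
   cycle that vanishes at all its distinct values of [h]. *)
pose p : {poly K} := \sum_(j | fconnect g x (val j)) c j *: 'X^(findex g x (val j)).
have p_size : (size p <= fingraph.order g x)%N.
  apply: (leq_trans (size_sum _ _ _)); apply/bigmax_leqP => j xj.
  by apply: (leq_trans (size_scale_leq _ _)); rewrite size_polyXn; apply: findex_max.
have p0 : p = 0.
  apply: (@roots_geq_poly_eq0 _ _ [seq h i | i <- fingraph.orbit g x]).
  - apply/allP => y /mapP [i]; rewrite -fconnect_orbit => xi ->.
    have Pi : P i by rewrite -(Pg _ _ xi) (Pg _ _ x0) (valP j0).
    have rE : froot g i = x.
      by apply/eqP; rewrite root_connect // (connect_trans _ x0) // g_sym.
    rewrite /root /p horner_sum -[X in _ == X](cE (Sub i Pi)) big_mkcond /=.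
    apply/eqP/eq_bigr => j _; rewrite /cycle_vandermonde /= rE.
    rewrite (same_connect g_sym xi); case: ifP => _; last by rewrite mul0r.
    by rewrite hornerZ hornerXn mulrC.
  - rewrite map_inj_in_uniq ?orbit_uniq // => i j; rewrite -!fconnect_orbit => xi xj.
    by apply: h_inj; rewrite -(same_connect g_sym xi).
  - by rewrite size_map size_orbit.
have /(congr1 (coefp (findex g x (val j0)))) := p0; rewrite /= coef0 coef_sum.
rewrite (bigD1 j0) //= big1 ?addr0 => [|j /andP [xj jj0]].
  by rewrite coefZ coefXn eqxx mulr1.
rewrite coefZ coefXn; case: eqP => [E|_]; last by rewrite mulr0.
case/eqP: jj0; apply: val_inj.
by rewrite -[LHS](iter_findex xj) -[RHS](iter_findex x0) E.
Qed.

End CycleMatrix.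

Section GoodPoint.
Variables (K : closedFieldType) (n' r : nat).
Let n := n'.+3.
Variable e : 'I_(#|{: label r + label r}|.-1) -> 'I_n.
Variable ell : label r -> 'I_n -> K.
Let T : finType := {i : 'I_n | i \notin codom e}.
Variables (B : 'I_n -> T -> K) (B' : T -> T -> K).
Hypothesis BK : forall i l : T, \sum_j B (val i) j * B' j l = (i == l)%:R.

Definition pencil (a1 b1 : 'I_r -> K) (i : 'I_n) : K * K :=
  (comb ell (fun l => match l with inl b => (~~ b)%:R | inr j => a1 j end) i,
   comb ell (fun l => match l with inl b => b%:R | inr j => b1 j end) i).

(** Only S imposes conditions on the interpolant. The other labels receive distinct affine values
    away from the points [Q i], and [B'] converts these values into parameters. *)
Lemma good_exists (a1 b1 : 'I_r -> K) (Q := pencil a1 b1) :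
    (forall i, i \in codom e -> Q i != (0, 0)) ->
    {in codom e &, forall i j, i != j -> hbr (Q i) (Q j) != 0} ->
    (forall u v, interpolates e ell Q u v -> exists c,
       [/\ u pivot0 = c, u pivot1 = 0, forall j, u (inr j) = c * a1 j
         & [/\ v pivot0 = 0, v pivot1 = c & forall j, v (inr j) = c * b1 j]]) ->
  exists a, good ell B a.
Proof.
move=> Q0 Q_ind Q_ker.
have [x [x_inj xQ]] := injective_avoid T [seq (Q i).1 / (Q i).2 | i : 'I_n].
pose a (k : param_idx e) := match k with
  | inl (inl j) => a1 j | inl (inr j) => b1 j
  | inr t => \sum_(l : T) B' t l * x l end.
have cfgS i : i \in codom e -> cfg ell B a i = Q i by move=> iS; rewrite /cfg iS.
have cfgT i (iT : i \notin codom e) : cfg ell B a i = (x (Sub i iT), 1).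
  rewrite /cfg (negbTE iT) /=; congr pair; under eq_bigr do rewrite mulr_sumr.
  rewrite exchange_big /= (bigD1 (Sub i iT)) //= [X in _ + X]big1 ?addr0 => [|k kt].
    under eq_bigr do rewrite mulrA; rewrite -mulr_suml.
    by rewrite (BK (Sub i iT) (Sub i iT)) eqxx mul1r.
  under eq_bigr do rewrite mulrA; rewrite -mulr_suml.
  by rewrite (BK (Sub i iT) k) eq_sym (negbTE kt) mul0r.
have hST i j (jT : j \notin codom e) : i \in codom e -> hbr (Q i) (x (Sub j jT), 1) != 0.
  move=> iS; have := Q0 i iS; have : x (Sub j jT) != (Q i).1 / (Q i).2.
    by apply: contraNneq (xQ (Sub j jT)) => ->; rewrite image_f.
  rewrite /hbr; case: (Q i) => y1 y2; rewrite /= mulr1 => xy; rewrite -pair_eqE /= negb_and.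
  have [->|y2_0 _] := eqVneq y2 0; first by rewrite mul0r subr0 orbF.
  by rewrite subr_eq0; apply: contraNneq xy => ->; rewrite mulrC mulKf.
exists a; apply/goodP; split.
  move=> i j ij; have [iS|iT] := boolP (i \in codom e); have [jS|jT] := boolP (j \in codom e).
  - by rewrite !cfgS // Q_ind.
  - by rewrite cfgS // cfgT hST.
  - by rewrite cfgT (cfgS j) // hbrC oppr_eq0 hST.
  rewrite !cfgT /hbr /= mulr1 mul1r subr_eq0 (inj_eq x_inj).
  by apply: contra ij => /eqP /(congr1 val) /= ->.
move=> u v uv; have [|c [u0 u1 uj [v0 v1 vj]]] := Q_ker u v.
  by move=> i iS; rewrite -cfgS //; apply: uv.
by exists c; split=> -[[]|j]; rewrite /= ?mulr0 ?mulr1.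
Qed.

End GoodPoint.

(** * Rationality *)

Section MomentCurve.
Variables (K : closedFieldType) (n' r : nat).
Let n := n'.+3.
Variables (S : {set 'I_n}) (p : 'I_n -> K).
Hypothesis S_card : #|S| = r.*2.+3.
Hypothesis p_inj : {in S &, injective p}.

(** The pivots are the degrees 1 and 0, so the simplest pencil in echelon form is (X : 1). *)
Definition label_deg (l : label r) : nat :=
  match l with inl b => nat_of_bool (~~ b) | inr j => j.+2 end.

Definition moment (l : label r) (i : 'I_n) : K := p i ^+ label_deg l.

Definition label_poly (u : label r -> K) : {poly K} := \sum_l u l *: 'X^(label_deg l).

Lemma label_deg_inj : injective label_deg.
Proof. by move=> [[]|i] [[]|j] //= [] /ord_inj ->. Qed.

Lemma label_poly_size u : (size (label_poly u) <= r.+2)%N.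
Proof.
apply: (leq_trans (size_sum _ _ _)); apply/bigmax_leqP => l _.
apply: (leq_trans (size_scale_leq _ _)); rewrite size_polyXn ltnS.
by case: l => [[]|j] //=; rewrite ltnS.
Qed.

Lemma label_poly_coef u l : (label_poly u)`_(label_deg l) = u l.
Proof.
rewrite coef_sum (bigD1 l) //= big1 ?addr0 => [|k kl].
  by rewrite coefZ coefXn eqxx mulr1.
by rewrite coefZ coefXn (inj_eq label_deg_inj) eq_sym (negbTE kl) mulr0.
Qed.

Lemma comb_moment u i : comb moment u i = (label_poly u).[p i].
Proof. by rewrite horner_sum; apply: eq_bigr => l _; rewrite hornerZ hornerXn. Qed.

(** The pencil is (A : 1) with A = X + t X^(r+1), or A = X for [r = 0]. For any interpolant (u, v)
    the polynomial u - v A has degree at most 2r + 2 and vanishes at 2r + 3 parameters, so u = v A.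
    Since A has degree r + 1, the largest degree available to u, v is constant. *)
Lemma moment_pencil : exists (a1 b1 : 'I_r -> K),
  let Q := pencil moment a1 b1 in
  [/\ forall i, i \in S -> Q i != (0, 0),
      {in S &, forall i j, i != j -> hbr (Q i) (Q j) != 0}
    & forall u v,
      (forall i, i \in S -> comb moment u i * (Q i).2 = comb moment v i * (Q i).1) ->
      exists c, [/\ u pivot0 = c, u pivot1 = 0, forall j, u (inr j) = c * a1 j
        & [/\ v pivot0 = 0, v pivot1 = c & forall j, v (inr j) = c * b1 j]]].
Proof.
(* For [r > 0] this is the difference of the values of A at two parameters, as a polynomial in the
   coefficient t; it is nonzero at t = 0. The extra factor ['X] below keeps the degree of A equal to
   r + 1. *)
pose L (ij : 'I_n * 'I_n) : {poly K} :=
  (p ij.1 - p ij.2)%:P + (p ij.1 ^+ r.+1 - p ij.2 ^+ r.+1) *: 'X.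
pose SS := [seq ij <- enum {: 'I_n * 'I_n} | [&& ij.1 \in S, ij.2 \in S & ij.1 != ij.2]].
have [t] : exists t, ('X * \prod_(ij <- SS) L ij).[t] != 0.
  apply: poly_nonroot; rewrite mulf_neq0 ?polyX_eq0 // prodf_seq_neq0.
  apply/allP => -[i j]; rewrite mem_filter => /andP [/and3P [/= iS jS ij] _] /=.
  apply: contraNneq ij => /(congr1 (fun f => f.[0])).
  rewrite /L hornerD hornerC hornerZ hornerX mulr0 addr0 horner0 /= => E.
  by apply/eqP/(p_inj iS jS)/eqP; rewrite -subr_eq0 E.
rewrite hornerM hornerX mulf_eq0 negb_or horner_prod prodf_seq_neq0 => /andP [t0 /allP tL].
pose a1 (j : 'I_r) : K := if j.+1 == r then t else 0.
pose b1 (j : 'I_r) : K := 0.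
pose A (l : label r) : K := match l with inl b => (~~ b)%:R | inr j => a1 j end.
exists a1, b1 => Q.
have Q1 i : (Q i).1 = (label_poly A).[p i] by rewrite -comb_moment.
have Q2 i : (Q i).2 = 1.
  rewrite /= /comb big_sumType /= [X in _ + X]big1 ?addr0 => [|j _]; last by rewrite mul0r.
  rewrite (bigD1 true) //= mul1r [X in _ + X]big1 ?addr0 => [|[] // _]; last by rewrite mul0r.
  by rewrite /moment.
have A_lead : (label_poly A)`_r.+1 != 0.
  case: (posnP r) => [r0|r0].
    by rewrite {1}r0 (label_poly_coef A pivot0) /= oner_neq0.
  have rr : (r.-1 < r)%N by rewrite prednK.
  have := label_poly_coef A (inr (Ordinal rr)); rewrite /= prednK // => ->.
  by rewrite /a1 /= prednK // eqxx.
have A_size : size (label_poly A) = r.+2.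
  by apply/eqP; rewrite eqn_leq label_poly_size; apply: contraTT A_lead; rewrite -leqNgt => /leq_sizeP ->; rewrite ?eqxx.
have A_eval x : (label_poly A).[x] = x + (if r is 0 then 0 else t * x ^+ r.+1).
  rewrite horner_sum big_sumType /= (bigD1 false) //= big1 => [|[] // _]; last by rewrite hornerZ mul0r.
  rewrite scale1r hornerXn expr1 addr0; congr (_ + _).
  rewrite /a1; case: (r) => [|k]; first by rewrite big_ord0.
  rewrite big_ord_recr /= eqxx hornerZ hornerXn big1 ?add0r // => j _.
  by rewrite eqSS ltn_eqF // scale0r horner0.
split.
- by move=> i _; rewrite [Q i]surjective_pairing Q2 -pair_eqE /= oner_eq0 andbF.
- move=> i j iS jS ij; rewrite /hbr !Q2 mulr1 mul1r !Q1 !A_eval.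
  have : (L (i, j)).[t] != 0.
    by apply: tL; rewrite mem_filter /= iS jS ij mem_enum.
  rewrite /L hornerD hornerC hornerZ hornerX /=.
  case: (r) => [_|k]; last first.
    by apply: contraNneq => E; apply/eqP; rewrite -[RHS]E; ring.
  by rewrite !addr0 subr_eq0 (inj_in_eq p_inj).
move=> u v uv.
have E : label_poly u = label_poly v * label_poly A.
  apply/eqP; rewrite -subr_eq0; apply/eqP.
  apply: (@roots_geq_poly_eq0 _ _ [seq p i | i <- enum S]).
  - apply/allP => y /mapP [i]; rewrite mem_enum => iS ->.
    have := uv i iS; rewrite Q2 Q1 !comb_moment mulr1 => E.
    by rewrite /root hornerD hornerN hornerM E subrr.
  - by rewrite map_inj_in_uniq ?enum_uniq // => i j; rewrite !mem_enum; apply: p_inj.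
  rewrite size_map -cardE S_card.
  apply: (leq_trans (size_polyD _ _)); rewrite size_polyN geq_max.
  apply/andP; split; first by apply: (leq_trans (label_poly_size u)); lia.
  apply: (leq_trans (size_polyMleq _ _)); rewrite A_size.
  by have := label_poly_size v; move: (size _) => k; rewrite -addnn; lia.
have v_size : (size (label_poly v) <= 1)%N.
  have [->|v0] := eqVneq (label_poly v) 0; first by rewrite size_poly0.
  have A0 : label_poly A != 0 by rewrite -size_poly_gt0 A_size.
  by have := label_poly_size u; rewrite E size_mul // A_size; move: (size _) => k; lia.
have vE := size1_polyC v_size; exists (v pivot1).
have v1 : (label_poly v)`_0 = v pivot1 by rewrite -(label_poly_coef v pivot1).
rewrite v1 in vE.
have uE l : u l = v pivot1 * A l.
  by rewrite -(label_poly_coef u) E vE coefCM label_poly_coef.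
have v0 l : l != pivot1 -> v l = 0.
  by move=> l1; rewrite -(label_poly_coef v) vE coefC; case: l l1 => [[]|j].
split; [by rewrite uE /= mulr1|by rewrite uE /= mulr0|by move=> j; rewrite uE|].
by split=> [|//|j]; rewrite v0 // /b1 mulr0.
Qed.

End MomentCurve.

(** * Choice of the interpolation set by cycle type *)

Section Existence.
Variables (F : finFieldType) (K : closedFieldType) (iota : {rmorphism F -> K}).
Hypothesis algK : integralRange iota.
Variables (n' : nat).
Let n := n'.+3.
Variable rho : galrep iota n.
Local Notation g := (rho (frob iota 1)).

(** [cycle_vandermonde] provides the substitution for the labels outside S, so all that is left to
    supply is an equivariant [ell] on S with a pencil that is its only interpolant up to scalars. *)
Lemma rational_of_pencil r (S : {set 'I_n}) (ell : label r -> 'I_n -> K) (a1 b1 : 'I_r -> K) :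
    let Q := pencil ell a1 b1 in
    #|S| = r.*2.+3 -> (forall i j, fconnect g i j -> (i \in S) = (j \in S)) ->
    (forall (s : absgal iota) l i, i \in S -> s (ell l i) = ell l (rho s i)) ->
    [/\ forall i, i \in S -> Q i != (0, 0),
      {in S &, forall i j, i != j -> hbr (Q i) (Q j) != 0}
    & forall u v,
      (forall i, i \in S -> comb ell u i * (Q i).2 = comb ell v i * (Q i).1) ->
      exists c, [/\ u pivot0 = c, u pivot1 = 0, forall j, u (inr j) = c * a1 j
        & [/\ v pivot0 = 0, v pivot1 = c & forall j, v (inr j) = c * b1 j]]] ->
  rational (twisted_Mbar rho).
Proof.
move=> Q cS S_stable ell_equiv [Q0 Q_ind Q_ker].
have [e eS] := enum_label_codom cS.
have g_inj : injective g by exact: perm_inj.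
have g_sym : connect_sym (frel g) by exact: fconnect_sym.
have [h [hg _ h_inj]] := cycle_generator iota g.
pose P i := i \notin codom e.
have Pg i j : fconnect g i j -> P i = P j by move=> ij; rewrite /P !eS (S_stable i j ij).
pose B (i : 'I_n) (j : {i : 'I_n | i \notin codom e}) := cycle_vandermonde g h i (val j).
have [B' [BK B'K]] := fun_inverse (fun c => cycle_vandermonde_inj h_inj (P := P) (c := c) Pg).
apply: (rational_of_frame_data (B := B) BK B'K (rho := rho) (ell := ell)).
- by move=> s i; rewrite !eS -(S_stable i) // galrep_connect.
- by move=> s l i; rewrite eS; apply: ell_equiv.
- move=> s i j _; rewrite /B /cycle_vandermonde.
  have is_ : fconnect g i (rho s i) by apply: galrep_connect.
  rewrite -(same_connect g_sym is_).
  have -> : froot g (rho s i) = froot g i by apply/eqP; rewrite eq_sym root_connect.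
  case: ifP => _; last by rewrite rmorph0.
  by rewrite rmorphXn (equivariant_iter algK s hg).
apply: (good_exists BK (a1 := a1) (b1 := b1)).
- by move=> i; rewrite eS; apply: Q0.
- by move=> i j; rewrite !eS; apply: Q_ind.
by move=> u v uv; apply: Q_ker => i iS; apply: uv; rewrite eS.
Qed.

Lemma rational_of_moment r (S : {set 'I_n}) (p : 'I_n -> K) :
    #|S| = r.*2.+3 -> (forall i j, fconnect g i j -> (i \in S) = (j \in S)) ->
    (forall i, i \in S -> p (g i) = frob iota 1 (p i)) -> {in S &, injective p} ->
  rational (twisted_Mbar rho).
Proof.
move=> cS S_stable pg p_inj.
have [a1 [b1 pencilP]] := moment_pencil cS p_inj.
apply: (rational_of_pencil cS S_stable _ pencilP) => s l i iS.
rewrite /moment rmorphXn; congr (_ ^+ _).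
have [N [sN rhoN]] := galrep_iter algK rho s [seq p i | i : 'I_n].
rewrite rhoN sN ?image_f //; elim: N {sN rhoN} i iS => [|N IH] i iS.
  by rewrite frobE expn0 expr1.
rewrite iterSr -IH ?pg // -?frob_comp ?addn1 //.
by rewrite -(S_stable i) // fconnect1.
Qed.

(** The pairs ([ell pivot0 i], [ell pivot1 i]) at the three labels are (1, 0), (0, 1) and (1, 1),
    rational over every field. *)
Lemma rational_trivial : (forall i, g i = i) -> rational (twisted_Mbar rho).
Proof.
move=> g1; pose S : {set 'I_n} := [set pt0 n'; pt1 n'; pt2 n'].
have rho1 (s : absgal iota) i : rho s i = i.
  by have [N [_ ->]] := galrep_iter algK rho s [::]; elim: N => //= N ->.
pose ell (l : label 0) (i : 'I_n) : K :=
  match l with inl b => (i != if b then pt0 n' else pt1 n')%:R | inr _ => 0 end.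
pose z (j : 'I_0) : K := 0.
have combE u i : comb ell u i = u pivot0 * ell pivot0 i + u pivot1 * ell pivot1 i.
  rewrite /comb big_sumType /= big_ord0 addr0 (bigD1 false) //= (bigD1 true) //=.
  by rewrite big1 ?addr0 // => -[].
apply: (@rational_of_pencil 0 S ell z z).
- by rewrite /S -setUA cardsU1 cards2 !inE.
- by move=> i j /iter_findex <-; elim: (findex _ _ _) => //= k IH; rewrite g1.
- by move=> s [b|j] i _; rewrite rho1 /ell ?rmorph0 // rmorph_nat.
split.
- move=> i _; rewrite /pencil !combE -pair_eqE /= !mul1r !mul0r addr0 add0r.
  by have [->|_] := eqVneq i (pt1 n'); rewrite ?oner_eq0 //= ?andbF // eqxx oner_eq0.
- by move=> i j; rewrite !inE /pencil !combE /hbr /= => /orP [/orP []|] /eqP -> /orP [/orP []|] /eqP -> //= _;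
   rewrite ?(mul1r, mul0r, mulr1, mulr0, addr0, add0r, subr0, sub0r, oppr_eq0) oner_neq0.
move=> u v uv.
have := uv (pt0 n'); have := uv (pt1 n'); have := uv (pt2 n').
rewrite !inE !eqxx /= ?orbT /pencil !combE /= !(mul1r, mul0r, mulr1, mulr0, addr0, add0r).
move=> /(_ isT) E2 /(_ isT) E1 /(_ isT) E0.
rewrite E1 -E0 addr0 add0r in E2.
by exists (v pivot1); split; [|exact: E1|case|split; [rewrite -E0| |case]].
Qed.

Theorem rational_odd : odd n -> rational (twisted_Mbar rho).
Proof.
move=> n_odd.
have g_inj : injective g by exact: perm_inj.
have g_sym : connect_sym (frel g) by exact: fconnect_sym.
have [h [hg h0 h_inj]] := cycle_generator iota g.
pose C i : {set 'I_n} := [set j | fconnect g i j].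
have C_card i : #|C i| = fingraph.order g i by rewrite cardsE.
have C_stable i j k : fconnect g j k -> (j \in C i) = (k \in C i).
  by move=> jk; rewrite !inE ![fconnect g i _]g_sym (same_connect g_sym jk).
have [/existsP [i /andP [i_odd i3]]|no_odd] :=
    boolP [exists i, odd (fingraph.order g i) && (2 < fingraph.order g i)%N].
  (* A single odd cycle is S, so its length is 2r + 3. *)
  apply: (@rational_of_moment (fingraph.order g i - 3)./2 (C i) h) => //.
  - by rewrite C_card; have := odd_double_half (fingraph.order g i - 3); rewrite oddB // i_odd /=; lia.
  - by apply: C_stable.
  - move=> j k; rewrite !inE => ij ik; apply: h_inj; by rewrite -(same_connect g_sym ij).
have [/forallP g1|] := boolP [forall i, g i == i].
  by apply: rational_trivial => i; apply/eqP.
rewrite negb_forall => /existsP [i1 gi1].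
have [/existsP [i0 /eqP gi0]|no_fix] := boolP [exists i, g i == i].
  pose S := i0 |: C i1.
  have i0C : i0 \notin C i1.
    rewrite inE g_sym; apply/negP => /iter_findex; rewrite -[findex _ _ _]addn0.
    elim: (_ + _)%N => [/= E|k IH]; first by rewrite -E gi0 eqxx in gi1.
    by rewrite iterSr gi0.
  have even1 : ~~ odd (fingraph.order g i1).
    apply/negP => o1; move/existsP: no_odd; apply; exists i1; rewrite o1 /=.
    have : fingraph.order g i1 != 1%N.
      by apply: contraNneq gi1 => E; rewrite -[X in _ == X](iter_order g_inj) E.
    by case: (fingraph.order g i1) o1 => [|[|[|]]].
  have i1_gt0 := fingraph.order_gt0 g i1.
  (* Here S has one point more than the even cycle. The fixed point gets the parameter 0, which
     Frobenius fixes and which differs from the nonzero values of [h]. *)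
  apply: (@rational_of_moment (fingraph.order g i1 - 2)./2 S
    (fun i => if i == i0 then 0 else h i)).
  - rewrite /S cardsU1 i0C C_card /=.
    by have := odd_double_half (fingraph.order g i1); rewrite (negbTE even1); lia.
  - move=> j k jk; rewrite /S !in_setU1 (C_stable _ _ _ jk); congr (_ || _).
    have fixed0 l : fconnect g i0 l -> l = i0.
      by move/iter_findex <-; elim: (findex _ _ _) => //= a ->.
    apply/eqP/eqP => E; first by rewrite E in jk; rewrite (fixed0 _ jk).
    by rewrite E g_sym in jk; rewrite (fixed0 _ jk).
  - by move=> i _; rewrite -[X in g i == X]gi0 (inj_eq g_inj); case: eqP => _; rewrite ?rmorph0.
  - move=> j k; rewrite !inE; have [->|ji] := eqVneq j i0; have [->|ki] := eqVneq k i0 => //=.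
    + by move=> _ _ /esym/eqP; rewrite (negbTE (h0 k)).
    + by move=> _ _ /eqP; rewrite (negbTE (h0 j)).
    by move=> i1j i1k; apply: h_inj; rewrite -(same_connect g_sym i1j).
(* In the remaining case every cycle has even length, which contradicts the parity of [n]. *)
suff : ~~ odd #|'I_n| by rewrite card_ord n_odd.
rewrite -sum1_card (partition_big (froot g) predT) //= -dvdn2.
apply: dvdn_sum => x _; rewrite sum1_card.
have [/existsP [i /eqP ix]|no_x] := boolP [exists i, froot g i == x]; last first.
  rewrite eq_card0 ?dvdn0 // => i; rewrite !inE; apply/negP => ix.
  by case/existsP: no_x; exists i.
rewrite (@eq_card _ _ (fconnect g i)) => [|j]; last first.
  by rewrite -[LHS]/(froot g j == x) -[RHS]/(fconnect g i j) -ix eq_sym root_connect.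
rewrite -/(fingraph.order g i) dvdn2; apply/negP => oi; case/existsP: no_odd.
exists i; rewrite oi /=; have : fingraph.order g i != 1%N.
  by apply: contraNneq no_fix => E; apply/existsP; exists i; rewrite -[X in _ == X](iter_order g_inj) E.
by case: (fingraph.order g i) oi => [|[|[|]]].
Qed.

End Existence.

Theorem corollary15 (F : finFieldType) (K : closedFieldType)
    (iota : {rmorphism F -> K}) (algK : integralRange iota)
    (m : nat) (m_ge1 : (1 <= m)%N) (rho : galrep iota (2 * m + 1)%N) :
  rational (twisted_Mbar rho).
Proof.
have [n' nE] : exists n', (2 * m + 1)%N = n'.+3 by exists (2 * m - 2)%N; lia.
have : odd (2 * m + 1) by rewrite addn1 mul2n /= odd_double.
by move: rho; rewrite nE => rho; apply: rational_odd.
Qed.
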